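(* Let $\rho,\sigma$ be real numbers with $1-\sigma^2>0$ and $1-2\rho^2+\sigma>0$, let $n\ge 1$ be an integer, and let $(A_1,B_1,C_1),\ldots,(A_n,B_n,C_n)$ be independent random vectors, each trivariate normally distributed with mean $(0,0,0)$ and covariance matrix $$\Sigma=\begin{pmatrix}1&\sigma&\rho\\ \sigma&1&\rho\\ \rho&\rho&1\end{pmatrix}.$$ Define $$\hat\gamma_{A,C}=\sum_{j=1}^n A_jC_j,\qquad \hat\gamma_{B,C}=\sum_{j=1}^n B_jC_j .$$ Set $$\xi=1-2\rho^2+\sigma,\quad \eta=\frac{1+\sigma}{1-\sigma},\quad \lambda=\frac{1}{\sqrt{1-\sigma}},\quad \kappa=\frac{1}{\sqrt{1-2\rho^2+\sigma}},\quad \delta=\frac{2\rho}{\xi},\quad \alpha=\frac{\sqrt{2\eta}}{\xi}.$$ Then the random vector $(\hat\gamma_{A,C},\hat\gamma_{B,C})$ has joint probability density (with respect to Lebesgue measure on $\mathbb{R}^2$) given, for $(x,y)\neq(0,0)$, by $$f_n(x,y)=\frac{1}{\Gamma(n/2)}\,\frac{\lambda^{n/2}\kappa^{n/2}}{2^{n/2}\,\pi\,\alpha^{(n-2)/2}}\,\exp\!\left(\frac{x+y}{2}\,\delta\right)\left(\kappa^2(x+y)^2+\lambda^2(x-y)^2\right)^{(n-2)/4}K_{(n-2)/2}\!\left(\frac{\alpha}{2\lambda\kappa}\sqrt{\kappa^2(x+y)^2+\lambda^2(x-y)^2}\right).$$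
   Context: $K_\nu$ denotes the modified Bessel function of the second kind of order $\nu$ (so $K_{-\nu}=K_\nu$), and $\Gamma$ is the Gamma function. The conditions $1-\sigma^2>0$ and $1-2\rho^2+\sigma>0$ ensure that $\Sigma$ is positive definite. *)

(* Defs.v *)
From HB Require Import structures.
From mathcomp Require Import all_boot all_order all_algebra.
From mathcomp Require Import all_classical all_reals all_analysis.

Set Implicit Arguments.
Unset Strict Implicit.
Unset Printing Implicit Defensive.

Import Order.TTheory GRing.Theory Num.Theory.
Import numFieldNormedType.Exports.

Local Open Scope classical_set_scope.
Local Open Scope ring_scope.

(* Euler's integral; it is the Gamma function only for 0 < a. *)
Definition Gamma (R : realType) (a : R) : R :=
  Rintegral (@lebesgue_measure R) `]0, +oo[
    (fun t => t `^ (a - 1) * expR (- t)).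

(* K_nu(z) = \int_0^oo exp(- z cosh t) cosh(nu t) dt, for real nu and 0 < z;
   the integral diverges, and the value is meaningless, for z <= 0. *)
Definition coshR (R : realType) (t : R) : R := (expR t + expR (- t)) / 2.

Definition besselK (R : realType) (nu z : R) : R :=
  Rintegral (@lebesgue_measure R) `[0, +oo[
    (fun t => expR (- (z * coshR t)) * coshR (nu * t)).

(* measurableTypeR R is R with the Borel sigma-algebra, under the display that
   lebesgue_measure expects; it is convertible to the canonical structure on R. *)
Definition lebesgue2 (R : realType) :
    {measure set (measurableTypeR R * measurableTypeR R) -> \bar R} :=
  (@lebesgue_measure R \x @lebesgue_measure R)%E.

Definition lebesgue3 (R : realType) :
    {measure set (measurableTypeR R * measurableTypeR R * measurableTypeR R)
       -> \bar R} :=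
  (@lebesgue_measure R \x @lebesgue_measure R \x @lebesgue_measure R)%E.

Definition has_density (R : realType) (d d' : measure_display)
    (T : measurableType d) (T' : measurableType d') (P : probability T R)
    (mu : {measure set T' -> \bar R}) (X : T -> T') (f : T' -> R) : Prop :=
  [/\ measurable_fun setT f, (forall x, 0 <= f x) &
      forall E : set T', measurable E ->
        P (X @^-1` E) = (\int[mu]_(x in E) (f x)%:E)%E].

Definition mutually_independent (R : realType) (d d' : measure_display)
    (T : measurableType d) (T' : measurableType d') (P : probability T R)
    (I : finType) (X : I -> T -> T') : Prop :=
  forall (J : {set I}) (E : I -> set T'), (forall i, measurable (E i)) ->
    P [set t | forall i, i \in J -> E i (X i t)] =
    (\prod_(i in J) P (X i @^-1` E i))%E.

(* Density of N(m, S) on row vectors, for S symmetric positive definite. *)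
Definition mvnormal_pdf (R : realType) (k : nat) (m : 'rV[R]_k) (S : 'M[R]_k)
    (x : 'rV[R]_k) : R :=
  (Num.sqrt ((2 * pi) ^+ k * \det S))^-1 *
  expR (- (((x - m) *m invmx S *m (x - m)^T) 0 0) / 2).

Definition row3 (R : realType) (p : R * R * R) : 'rV[R]_3 :=
  \row_(j < 3) nth 0 [:: p.1.1; p.1.2; p.2] j.

Definition trivariate_normal (R : realType) (d : measure_display)
    (T : measurableType d) (P : probability T R) (X : T -> R * R * R)
    (m : 'rV[R]_3) (S : 'M[R]_3) : Prop :=
  has_density P (@lebesgue3 R) X (fun p => mvnormal_pdf m S (row3 p)).

Definition Sigma (R : realType) (rho sigma : R) : 'M[R]_3 :=
  \matrix_(i < 3, j < 3)
    nth 0 (nth [::] [:: [:: 1; sigma; rho];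
                        [:: sigma; 1; rho];
                        [:: rho; rho; 1]] i) j.

(* Main.v *)
Require Import Defs.
From HB Require Import structures.
From mathcomp Require Import all_boot all_order all_algebra.
From mathcomp Require Import all_classical all_reals all_analysis.
From mathcomp Require Import measurable_realfun ring lra.

Set Implicit Arguments.
Unset Strict Implicit.
Unset Printing Implicit Defensive.

Import Order.TTheory GRing.Theory Num.Theory.
Import numFieldNormedType.Exports.

Local Open Scope classical_set_scope.
Local Open Scope ring_scope.

(** With xi = 1 - 2 rho^2 + sigma, the variables
      U = (A + B - 2 rho C) / sqrt (2 xi),
      V = (A - B) / sqrt (2 (1 - sigma))
    and C are independent standard normals ([mvnormal_pdf_Sigma]).  Given the
    C_j, the sums of the U_j C_j and of the V_j C_j are therefore independent
    centred normals of common variance w = C_1^2 + ... + C_n^2, and w has a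
    chi-square law with n degrees of freedom.  So the triple of sums of
    (U_j C_j, V_j C_j, C_j^2) has a density proportional to
      w^(n/2 - 1) exp (- w/2) phi_w(p) phi_w(q),
    where phi_w is the centred normal density of variance w; this is
    [mixture (n/2)].  The pair of sample covariances is a linear image
    ([covariance_pair]) of that triple; integrating w out leaves an integral of
    the form int w^(nu - 1) exp (- beta / w - gamma w) dw, which the substitution
    w = r exp t turns into a Bessel function ([integral_besselK]).

    The law of the triple is obtained without conditioning.  For one observation
    it is a change of variables ([product_triple_law]).  Sums of independent
    triples convolve densities ([partial_sum_law], [sum_density]), and mixtures
    are stable under convolution ([mixture_law_conv]): at fixed mixing
    variables the Gaussian factors convolve by completing the square
    ([gauss_kernelM]), and the Gamma factors convolve to a Gamma factor by
    homogeneity ([gamma_kernel_conv]).  Multiplicative constants are not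
    evaluated on the way: the total mass 1 of the final law determines its
    constant, and this is where Gamma (n/2) comes from
    ([mixture_law_constant]).

    Since the laws are tested on arbitrary Borel sets, the substitutions have to
    hold for measurable integrands; they are obtained from the uniqueness of
    measures that agree on intervals. *)

(** * Measures with a density *)

Section with_density.
Local Open Scope ereal_scope.
Context d (T : measurableType d) (R : realType).
Variables (mu : {measure set T -> \bar R}) (g : T -> R).
Hypotheses (mg : measurable_fun setT g) (g0 : forall x, (0 <= g x)%R).

(** The two proofs are arguments so that the measure structure below can be
    inferred from the term itself. *)
Definition with_density (_ : measurable_fun setT g)
  (_ : forall x, (0 <= g x)%R) (A : set T) : \bar R :=
  \int[mu]_(x in A) (g x)%:E.

Let with_density0 : with_density mg g0 set0 = 0.
Proof. by rewrite /with_density integral_set0. Qed.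

Let with_density_ge0 A : 0 <= with_density mg g0 A.
Proof. by apply: integral_ge0 => x _; rewrite lee_fin. Qed.

Let with_density_sigma_additive : semi_sigma_additive (with_density mg g0).
Proof.
move=> F mF tF mUF; rewrite /with_density ge0_integral_bigcup//=.
- by apply: is_cvg_nneseries => n _ _; apply: integral_ge0 => x _; rewrite lee_fin.
- by apply/measurable_EFinP; exact: measurable_funTS.
- by move=> x _; rewrite lee_fin.
Qed.

HB.instance Definition _ := isMeasure.Build _ _ _ (with_density mg g0)
  with_density0 with_density_ge0 with_density_sigma_additive.

Import HBNNSimple.

(** Linear on indicators, hence on simple functions, hence by monotone
    convergence on nonnegative measurable functions.  The hypothesis is on the
    values of nu, so that it applies to any law known to have a density. *)
Lemma ge0_integral_density (nu : {measure set T -> \bar R}) (f : T -> \bar R) :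
    (forall A, measurable A -> nu A = \int[mu]_(x in A) (g x)%:E) ->
    measurable_fun setT f -> (forall x, 0 <= f x) ->
  \int[nu]_x f x = \int[mu]_x ((g x)%:E * f x).
Proof.
move=> nuE mf f0; pose f_ := nnsfun_approx measurableT mf.
transitivity (limn (fun n => \int[nu]_x (f_ n x)%:E)).
  rewrite -monotone_convergence//=.
  - by apply: eq_integral => x _; apply/esym/cvg_lim => //; exact: cvg_nnsfun_approx.
  - by move=> n; exact/measurable_EFinP.
  - by move=> n x _; rewrite lee_fin.
  - by move=> x _ a b ab; rewrite lee_fin; exact/lefP/nd_nnsfun_approx.
transitivity (limn (fun n => \int[mu]_x ((g x)%:E * (f_ n x)%:E))); last first.
  rewrite -monotone_convergence//=.
  - apply: eq_integral => x _; apply/cvg_lim => //; apply: cvgeZl => //.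
    exact: cvg_nnsfun_approx.
  - by move=> n; apply: emeasurable_funM; exact/measurable_EFinP.
  - by move=> n x _; rewrite mule_ge0 ?lee_fin.
  - move=> x _ a b ab; apply: lee_wpmul2l; first by rewrite lee_fin.
    by rewrite lee_fin; exact/lefP/nd_nnsfun_approx.
congr (limn _); apply/funext => n.
under eq_integral do rewrite fimfunE -fsumEFin//.
rewrite ge0_integral_fsum//; last 2 first.
  - by move=> r; exact/measurable_EFinP/measurableT_comp.
  - by move=> r x _; rewrite nnfun_muleindic_ge0.
under [RHS]eq_integral.
  move=> x _; rewrite fimfunE -fsumEFin// ge0_mule_fsumr; last first.
    by move=> r; rewrite nnfun_muleindic_ge0.
  over.
rewrite [RHS]ge0_integral_fsum//; last 2 first.
  - move=> r; apply: emeasurable_funM => //; first exact/measurable_EFinP.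
    by apply/measurable_EFinP; do 2 apply/measurableT_comp => //.
  - move=> r x _; apply: mule_ge0; first by rewrite lee_fin.
    exact: nnfun_muleindic_ge0.
apply: eq_fsbigr => r _.
rewrite integralZl_indic_nnsfun// integral_indic//= setIT nuE//.
have [r0|r0] := leP 0%R r; last first.
  rewrite preimage_nnfun0// integral_set0 mule0.
  by rewrite integral0_eq// => x _; rewrite indic0 mulr0 mule0.
rewrite [in LHS]integral_mkcond/= -ge0_integralZl//.
- apply: eq_integral => x _; rewrite patchE indicE.
  by case: ifPn => _; rewrite ?mulr1 ?mulr0 ?mule0// muleC.
- apply/measurable_restrict => //; rewrite setTI; apply: measurable_funTS.
  exact/measurable_EFinP.
- by move=> x _; rewrite patchE; case: ifPn => //; rewrite lee_fin.
Qed.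

End with_density.

(** * Affine and exponential substitution *)

(** The pushforward as a measure, with the measurability of the map as an
    argument rather than as a pending obligation. *)
Definition image_measure (R : realType) d d' (T1 : measurableType d)
  (T2 : measurableType d') (m : {measure set T1 -> \bar R}) (f : T1 -> T2)
  (mf : measurable_fun setT f) : {measure set T2 -> \bar R} :=
  ltac:(refine (pushforward m f : {measure set T2 -> \bar R}); exact: mf).

Section substitution.
Local Open Scope ereal_scope.
Context (R : realType).
Notation mu := (@lebesgue_measure R).

(** Both sides are integrals against measures giving the interval from a to b
    the length b - a; for s < 0 the preimage is closed on the other side. *)
Lemma ge0_integral_affine (s m : R) (F : measurableTypeR R -> \bar R) :
    s != 0%R -> measurable_fun setT F -> (forall x, 0 <= F x) ->
  \int[mu]_x F x = `|s|%:E * \int[mu]_x F (s * x + m)%R.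
Proof.
move=> s0 mF F0.
have mphi : measurable_fun setT
    ((fun x => s * x + m)%R : measurableTypeR R -> measurableTypeR R).
  by apply: measurable_funD => //; exact: measurable_funM.
pose nu : {measure set (measurableTypeR R) -> \bar R} :=
  mscale (NngNum (normr_ge0 s)) (image_measure mu mphi).
have nuE A : measurable A -> mu A = nu A.
  apply: lebesgue_measure_unique => _ [[a b] _ <-] /=.
  rewrite /nu /= /mscale/= /pushforward/=.
  have [s_gt0|s_lt0] : (0 < s)%R \/ (s < 0)%R.
    by move: s0; rewrite neq_lt => /orP[]; [right|left].
  - rewrite (_ : _ @^-1` _ = `](a - m) / s, (b - m) / s]%classic)%R; last first.
      apply/seteqP; split=> x /=; rewrite !in_itv/= ltr_pdivrMr// ler_pdivlMr//.
        by rewrite ltrBlDr lerBrDr [(x * s)%R]mulrC.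
      by rewrite ltrBlDr lerBrDr [(x * s)%R]mulrC.
    rewrite !lebesgue_measure_itv/= !lte_fin ltr_pM2r ?invr_gt0// ltrD2r.
    case: ifPn => _; last by rewrite mule0.
    rewrite -!EFinD -EFinM -mulrBl gtr0_norm//; congr (_%:E).
    by field; rewrite gt_eqF.
  - rewrite (_ : _ @^-1` _ = `[(b - m) / s, (a - m) / s[%classic)%R; last first.
      apply/seteqP; split=> x /=; rewrite !in_itv/= ltr_ndivlMr// ler_ndivrMr//.
        by rewrite ltrBlDr lerBrDr [(x * s)%R]mulrC andbC.
      by rewrite ltrBlDr lerBrDr [(x * s)%R]mulrC andbC.
    rewrite !lebesgue_measure_itv/= !lte_fin ltr_nM2r ?invr_lt0// ltrD2r.
    case: ifPn => _; last by rewrite mule0.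
    rewrite -!EFinD -EFinM -mulrBl ltr0_norm//; congr (_%:E).
    by field; rewrite lt_eqF.
rewrite (eq_measure_integral nu); last by move=> A mA _; exact: nuE.
rewrite ge0_integral_mscale//=; congr (_ * _).
by rewrite ge0_integral_pushforward.
Qed.

Lemma integral_expR_itv (a b : R) : (a < b)%R ->
  \int[mu]_(x in `]a, b]) (expR x)%:E = (expR b - expR a)%:E.
Proof.
move=> ab; rewrite integral_itv_obnd_cbnd; last first.
  by apply/measurable_EFinP/measurable_funTS; exact: measurable_expR.
rewrite (continuous_FTC2 ab (F := expR)) ?EFinB//.
- by apply: continuous_subspaceT; exact: continuous_expR.
- split=> //.
  + by apply: cvg_at_right_filter; exact: continuous_expR.
  + by apply: cvg_at_left_filter; exact: continuous_expR.
- by move=> x _; rewrite derive1E derive_val.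
Qed.

(** The image under ln of Lebesgue measure on the positive half-line and the
    measure of density exp agree on bounded intervals, both giving
    exp b - exp a. *)
Lemma ge0_integral_expR (F : measurableTypeR R -> \bar R) :
    measurable_fun setT F -> (forall x, 0 <= F x) ->
  \int[mu]_(x in `]0%R, +oo[) F x = \int[mu]_t ((expR t)%:E * F (expR t)).
Proof.
move=> mF F0; pose D := `]0%R, +oo[%classic : set R.
have mD : measurable (D : set (measurableTypeR R)) by exact: measurable_itv.
have m1D : measurable_fun setT (\1_D : measurableTypeR R -> R).
  exact: measurable_indic.
have D0 x : (0 <= \1_D x :> R)%R by [].
have mexp : measurable_fun setT (expR : measurableTypeR R -> measurableTypeR R).
  exact: measurable_expR.
have mln : measurable_fun setT (@ln R : measurableTypeR R -> measurableTypeR R).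
  exact: measurable_ln.
pose m1 : {measure set (measurableTypeR R) -> \bar R} :=
  image_measure (with_density mu m1D D0) mln.
pose m2 : {measure set (measurableTypeR R) -> \bar R} :=
  with_density mu mexp (@expR_ge0 R).
have m12 A : ocitv A -> m1 A = m2 A.
  move=> [[a b] _ <-] /=.
  have [ab|ba] := ltP a b; last first.
    by rewrite set_itv_ge ?measure0// bnd_simp -leNgt.
  rewrite /m2/= /with_density integral_expR_itv// /m1 /= /pushforward/=.
  have mab : measurable (@ln R @^-1` `]a, b] : set (measurableTypeR R)).
    by rewrite -[X in measurable X]setTI; have mln' := mln; exact: mln'.
  rewrite /with_density integral_indic//.
  rewrite (_ : _ `&` _ = `]expR a, expR b]%classic).
    by rewrite /= lebesgue_measure_itv/= lte_fin ltr_expR ab EFinB.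
  apply/seteqP; split=> x /=; rewrite /D/= !in_itv/= andbT.
    move=> [x0 /andP[ax xb]].
    by rewrite -[x]lnK ?posrE// ltr_expR ler_expR ax.
  move=> /andP[ax xb]; have x0 : (0 < x)%R by rewrite (lt_trans _ ax) ?expR_gt0.
  by split=> //; rewrite -ltr_expR -ler_expR lnK ?posrE// ax.
have m12E A : measurable A -> m1 A = m2 A.
  move=> mA; apply: (@measure_unique _ R (measurableTypeR R) (@ocitv R)
    (fun n => `](- n%:R)%R, n%:R]%classic) _ _ _ _ m1 m2) => //.
  - exact: ocitvI.
  - by move=> n; exists (- n%:R, n%:R)%R.
  - rewrite -subTset => x _; exists (Num.truncn `|x|).+1 => //=.
    rewrite in_itv/=; have := truncnS_gt `|x|; rewrite ltr_norml => /andP[-> /ltW].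
    by [].
  - move=> n; rewrite m12; last by exists (- n%:R, n%:R)%R.
    rewrite /m2/= /with_density.
    have [n0|n0] := ltP (- n%:R)%R (n%:R : R)%R.
      by rewrite integral_expR_itv// ltry.
    by rewrite set_itv_ge ?integral_set0// bnd_simp -leNgt.
transitivity (\int[m1]_t F (expR t)).
  rewrite ge0_integral_pushforward//=; last first.
    exact: (measurableT_comp mF mexp).
  rewrite preimage_setT (ge0_integral_density m1D D0 (mu := mu))//=; last first.
    exact: (measurableT_comp mF (measurableT_comp mexp mln)).
  rewrite integral_mkcond; apply: eq_integral => x _.
  rewrite patchE indicE; case: ifPn => xD; last by rewrite mul0e.
  by rewrite mul1e lnK//; move: xD; rewrite inE /D/= in_itv/= andbT.
rewrite (eq_measure_integral m2); last by move=> A mA _; exact: m12E.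
rewrite (ge0_integral_density mexp (@expR_ge0 R) (mu := mu))//.
exact: (measurableT_comp mF mexp).
Qed.
End substitution.

(** * Lebesgue measure in the plane and in space *)

Section sigma_finite_product.
Context (R : realType) d1 d2 (T1 : measurableType d1) (T2 : measurableType d2).
Variables (m1 : {sigma_finite_measure set T1 -> \bar R}).
Variables (m2 : {sigma_finite_measure set T2 -> \bar R}).
Local Open Scope ereal_scope.

Let sigma_finite_product_subproof : sigma_finite setT (m1 \x m2).
Proof.
have /sigma_finiteP[F [FT ndF Foo]] := sigma_finiteT m1.
have /sigma_finiteP[G [GT ndG Goo]] := sigma_finiteT m2.
exists (fun n => F n `*` G n).
  apply/seteqP; split=> // -[x y] _.
  have [i _ Fx] : (\bigcup_i F i) x by rewrite -FT.
  have [j _ Gy] : (\bigcup_i G i) y by rewrite -GT.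
  exists (maxn i j) => //; split=> /=.
    by have /subsetPset := ndF _ _ (leq_maxl i j); exact.
  by have /subsetPset := ndG _ _ (leq_maxr i j); exact.
move=> n; have [mF Fn] := Foo n; have [mG Gn] := Goo n.
by split; [exact: measurableX|rewrite product_measure1E// lte_mul_pinfty// ge0_fin_numE].
Qed.

(** Packed as a sigma-finite measure so that Tonelli's theorem can be iterated
    over three and more factors. *)
Definition sigma_finite_product :
    {sigma_finite_measure set (T1 * T2)%type -> \bar R} :=
  HB.pack (m1 \x m2) (Measure_isSigmaFinite.Build _ _ _ (m1 \x m2)
    sigma_finite_product_subproof).

End sigma_finite_product.

Section plane_and_space.
Local Open Scope ereal_scope.
Context (R : realType).
Notation RR := (measurableTypeR R).
Notation mu := (@lebesgue_measure R).
Notation mu2 := (lebesgue2 R).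
Notation mu3 := (lebesgue3 R).

Definition sigma_finite_lebesgue2 :
    {sigma_finite_measure set (RR * RR)%type -> \bar R} :=
  sigma_finite_product mu mu.

Definition sigma_finite_lebesgue3 :
    {sigma_finite_measure set (RR * RR * RR)%type -> \bar R} :=
  sigma_finite_product sigma_finite_lebesgue2 mu.

Lemma lebesgue2_tonelli (F : RR * RR -> \bar R) :
    measurable_fun setT F -> (forall x, 0 <= F x) ->
  \int[mu2]_z F z = \int[mu]_x \int[mu]_y F (x, y).
Proof. exact: fubini_tonelli1. Qed.

Lemma lebesgue3_tonelli (F : RR * RR * RR -> \bar R) :
    measurable_fun setT F -> (forall x, 0 <= F x) ->
  \int[mu3]_z F z = \int[mu]_w \int[mu2]_z F (z, w).
Proof.
move=> mF F0.
exact: (@fubini_tonelli2 _ _ _ _ _ sigma_finite_lebesgue2 mu F mF F0).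
Qed.

Lemma lebesgue3_tonelli_swap (F : RR * RR * RR -> \bar R) :
    measurable_fun setT F -> (forall x, 0 <= F x) ->
  \int[mu]_w \int[mu2]_z F (z, w) = \int[mu2]_z \int[mu]_w F (z, w).
Proof.
move=> mF F0.
exact/esym/(@fubini_tonelli _ _ _ _ _ sigma_finite_lebesgue2 mu F mF F0).
Qed.

Lemma measurable_integral_lebesgue (F : RR * RR -> \bar R) :
    measurable_fun setT F -> (forall x, 0 <= F x) ->
  measurable_fun setT (fun x => \int[mu]_y F (x, y)).
Proof. exact: measurable_fun_fubini_tonelli_F. Qed.

Lemma measurable_integral_lebesgue2 (F : RR * RR * RR -> \bar R) :
    measurable_fun setT F -> (forall x, 0 <= F x) ->
  measurable_fun setT (fun w => \int[mu2]_z F (z, w)).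
Proof.
exact: (@measurable_fun_fubini_tonelli_G _ _ _ _ _ sigma_finite_lebesgue2).
Qed.

(** The determinant of the map is - 2 / (s1 s2).  The two coordinates are
    substituted one after the other, so that only the affine substitution on
    the line is used. *)
Lemma ge0_integral_plane_affine (m s1 s2 : R) (F : RR * RR -> \bar R) :
    s1 != 0%R -> s2 != 0%R -> measurable_fun setT F -> (forall x, 0 <= F x) ->
  \int[mu2]_z F z = (2 / `|s1 * s2|)%:E *
    \int[mu2]_z F ((z.1 + z.2 - m) / s1, (z.1 - z.2) / s2)%R.
Proof.
move=> s10 s20 mF F0.
have mlin : measurable_fun setT (fun z : RR * RR =>
    ((z.1 + z.2 - m) / s1, (z.1 - z.2) / s2)%R : RR * RR).
  apply: measurable_fun_pair.
    by apply: measurable_funM => //; apply: measurable_funB => //; exact: measurable_funD.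
  by apply: measurable_funM => //; exact: measurable_funB.
have mlin1 : measurable_fun setT (fun z : RR * RR =>
    (z.1, 2 / s2 * z.2 - (s1 * z.1 + m) / s2)%R : RR * RR).
  apply: measurable_fun_pair => //; apply: measurable_funB; first exact: measurable_funM.
  by apply: measurable_funM => //; apply: measurable_funD => //; exact: measurable_funM.
(* x replaces q = (x - y) / s2 while p is fixed: there y = s1 p + m - x. *)
transitivity (`|2 / s2|%:E * \int[mu]_p \int[mu]_x
    F (p, 2 / s2 * x - (s1 * p + m) / s2)%R).
  rewrite (lebesgue2_tonelli mF F0) -ge0_integralZl_EFin//; last 2 first.
    by move=> p _; exact: integral_ge0.
    exact: (measurable_integral_lebesgue (measurableT_comp mF mlin1) (fun=> F0 _)).
  apply: eq_integral => p _.
  rewrite [LHS](@ge0_integral_affine R (2 / s2) (- ((s1 * p + m) / s2)))%R//.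
  - by rewrite mulf_neq0// ?invr_eq0.
  - exact: (measurableT_comp mF (pair1_measurable p)).
rewrite (fubini_tonelli (fun z : RR * RR =>
  F (z.1, 2 / s2 * z.2 - (s1 * z.1 + m) / s2)%R))//; last first.
  exact: (measurableT_comp mF mlin1).
rewrite (lebesgue2_tonelli (measurableT_comp mF mlin) (fun=> F0 _)).
rewrite /=.
transitivity (`|2 / s2|%:E * (`|s1^-1|%:E * \int[mu]_x \int[mu]_y
  F ((x + y - m) / s1, (x - y) / s2)%R)).
  congr (_ * _); rewrite -ge0_integralZl_EFin//; last 2 first.
    by move=> p _; exact: integral_ge0.
    exact: (measurable_integral_lebesgue (measurableT_comp mF mlin) (fun=> F0 _)).
  apply: eq_integral => x _.
  rewrite [LHS](@ge0_integral_affine R s1^-1 ((x - m) / s1))%R ?invr_eq0//; last first.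
    apply: (measurableT_comp mF); apply: measurable_fun_pair => //.
    apply: measurable_funB => //; apply: measurable_funM => //.
    by apply: measurable_funD => //; exact: measurable_funM.
  congr (_ * _); apply: eq_integral => y _; congr (F (_, _)).
    by field.
  by field; rewrite s10 s20.
rewrite muleA -EFinM; congr (_%:E * _).
by rewrite !normrM !normfV ger0_norm// invfM mulrCA mulrA mulrC mulrA.
Qed.

Lemma ge0_integral_shift2 (a b : R) (F : RR * RR -> \bar R) :
    measurable_fun setT F -> (forall x, 0 <= F x) ->
  \int[mu2]_z F (z.1 + a, z.2 + b)%R = \int[mu2]_z F z.
Proof.
move=> mF F0.
have msh : measurable_fun setT (fun z : RR * RR => (z.1 + a, z.2 + b)%R : RR * RR).
  by apply: measurable_fun_pair; apply: measurable_funD.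
have shift c (G : RR -> \bar R) : measurable_fun setT G -> (forall x, 0 <= G x) ->
    \int[mu]_x G (x + c)%R = \int[mu]_x G x.
  move=> mG G0; rewrite [RHS](@ge0_integral_affine R 1 c)// ?oner_eq0// normr1 mul1e.
  by apply: eq_integral => x _; rewrite mul1r.
rewrite (lebesgue2_tonelli (measurableT_comp mF msh) (fun=> F0 _)).
rewrite (lebesgue2_tonelli mF F0).
rewrite /= (shift a (fun x => \int[mu]_y F (x, y + b)%R)).
- apply: eq_integral => x _; apply: shift => //.
  exact: (measurableT_comp mF (pair1_measurable x)).
- apply: (@measurable_integral_lebesgue
    (fun z : RR * RR => F (z.1, z.2 + b)%R)) => //.
  apply: (measurableT_comp mF); apply: measurable_fun_pair => //.
  exact: measurable_funD.
- by move=> x; exact: integral_ge0.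
Qed.

Lemma ge0_integral_shift3 (a b c : R) (F : RR * RR * RR -> \bar R) :
    measurable_fun setT F -> (forall x, 0 <= F x) ->
  \int[mu3]_z F (z.1.1 + a, z.1.2 + b, z.2 + c)%R = \int[mu3]_z F z.
Proof.
move=> mF F0.
have msh : measurable_fun setT
    (fun z : RR * RR * RR => (z.1.1 + a, z.1.2 + b, z.2 + c)%R : RR * RR * RR).
  apply: measurable_fun_pair; last by apply: measurable_funD.
  by apply: measurable_fun_pair; apply: measurable_funD => //; exact: measurableT_comp.
rewrite (lebesgue3_tonelli (measurableT_comp mF msh) (fun=> F0 _)).
rewrite (lebesgue3_tonelli mF F0).
transitivity (\int[mu]_y \int[mu2]_z F (z, y + c)%R).
  apply: eq_integral => y _.
  rewrite -(ge0_integral_shift2 a b (F := fun z => F (z, y + c)%R))//.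
  exact: (measurableT_comp mF (pair2_measurable _)).
rewrite [RHS](@ge0_integral_affine R 1 c) ?oner_eq0//.
- by rewrite normr1 mul1e; apply: eq_integral => y _; rewrite mul1r.
- exact: measurable_integral_lebesgue2.
- by move=> y; exact: integral_ge0.
Qed.

End plane_and_space.

(** * Partial sums of independent variables *)

Section independence.
Local Open Scope ereal_scope.
Context (R : realType) d (T : measurableType d) (P : probability T R).

(** The event D is carried along because an induction over partial sums needs
    the independence of the past from all the later variables, not only from the
    next one. *)
Lemma independent_pair d1 d2 (V1 : measurableType d1) (V2 : measurableType d2)
    (X : {mfun T >-> V1}) (Y : {mfun T >-> V2}) (D : set T) :
    measurable D ->
    (forall A B, measurable A -> measurable B ->
      P (X @^-1` A `&` Y @^-1` B `&` D) =
      P (X @^-1` A) * P (Y @^-1` B) * P D) ->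
  forall G : set (V1 * V2), measurable G ->
    P ((fun t => (X t, Y t)) @^-1` G `&` D) =
    (distribution P X \x distribution P Y) G * P D.
Proof.
move=> mD indep G mG.
have mXY : measurable_fun setT (fun t => (X t, Y t)).
  by apply: measurable_fun_pair.
have mXYG : measurable ((fun t => (X t, Y t)) @^-1` G).
  by rewrite -[X in measurable X]setTI; have mXY' := mXY; exact: mXY'.
have PDfin : P D \is a fin_num by exact: fin_num_measure.
(* Both sides are measures in G that agree on rectangles; dividing by P D makes
   uniqueness of product measures applicable, and P D = 0 is trivial. *)
have [PD0|PD0] := eqVneq (P D) 0.
  rewrite PD0 mule0; apply/eqP; rewrite -measure_le0 -PD0.
  by rewrite le_measure ?inE//; exact: measurableI.
have r_gt0 : (0 < fine (P D))%R.
  by rewrite fine_gt0// lt_neqAle eq_sym PD0 measure_ge0 ltey_eq PDfin.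
have r0 : (0 <= (fine (P D))^-1)%R by rewrite invr_ge0 ltW.
pose m' : {measure set (V1 * V2) -> \bar R} :=
  mscale (NngNum r0) (image_measure (mrestr P mD) mXY).
rewrite (@product_measure_unique _ _ _ _ _ _ _ m')//.
  rewrite /m'/= /mscale/= /pushforward /mrestr muleAC.
  by rewrite -[X in _ * X * _](fineK PDfin) -EFinM mulVf ?gt_eqF// mul1e.
move=> A B mA mB; rewrite /m'/= /mscale/= /pushforward /mrestr.
rewrite (_ : _ @^-1` (A `*` B) `&` D = X @^-1` A `&` Y @^-1` B `&` D)//.
rewrite indep// -[X in _ * (_ * _ * X)](fineK PDfin) muleC -muleA -EFinM.
by rewrite mulfV ?gt_eqF// mule1.
Qed.

Section partial_sums.
Context d' (V : measurableType d') (op : V * V -> V) (n : nat).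
Hypothesis mop : measurable_fun setT op.
Variables (Y : 'I_n -> {mfun T >-> V}) (S : nat -> {mfun T >-> V}) (e : V).
Hypothesis S0 : forall t, S 0%N t = e.
Hypothesis SS : forall (i : 'I_n) t, S i.+1 t = op (S i t, Y i t).
Hypothesis indepY : mutually_independent P (fun i => Y i : T -> V).

Let later (J : {set 'I_n}) (E : 'I_n -> set V) :=
  [set t | forall i, i \in J -> E i (Y i t)].

Let measurable_later J E : (forall i, measurable (E i)) -> measurable (later J E).
Proof.
move=> mE; rewrite (_ : later J E = \bigcap_(i in [set i | i \in J]) (Y i @^-1` E i)).
  apply: fin_bigcap_measurable => // i _.
  by rewrite -[X in measurable X]setTI; exact: measurable_funP.
by apply/seteqP; split=> t /= Ht i; exact: Ht.
Qed.

Let indep_past k := forall (A : set V) (J : {set 'I_n}) (E : 'I_n -> set V),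
    measurable A -> (forall i, measurable (E i)) ->
    (forall i, i \in J -> k <= i)%N ->
  P (S k @^-1` A `&` later J E) =
  P (S k @^-1` A) * \prod_(i in J) P (Y i @^-1` E i).

Let indep_past_pair (i : 'I_n) : indep_past i ->
  forall (J : {set 'I_n}) (E : 'I_n -> set V) (G : set (V * V)),
    measurable G -> (forall i, measurable (E i)) ->
    (forall j, j \in J -> i < j)%N ->
  P ((fun t => (S i t, Y i t)) @^-1` G `&` later J E) =
  (distribution P (S i) \x distribution P (Y i)) G *
  \prod_(i in J) P (Y i @^-1` E i).
Proof.
move=> Hi J E G mG mE ltJ.
have PJ : P (later J E) = \prod_(i in J) P (Y i @^-1` E i) := indepY J mE.
rewrite -PJ.
apply: (@independent_pair _ _ _ _ (S i) (Y i)) => //; first exact: measurable_later.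
move=> A B mA mB; rewrite PJ.
pose E' j := if j == i then B else E j.
have iJ : i \notin J by apply/negP => /ltJ; rewrite ltnn.
rewrite (_ : _ `&` _ = S i @^-1` A `&` later (i |: J) E').
  rewrite Hi//.
  - rewrite big_setU1//= muleA /E' eqxx; congr (_ * _).
    by apply: eq_bigr => j jJ; case: eqP => // ji; rewrite ji (negbTE iJ) in jJ.
  - by move=> j; rewrite /E'; case: ifP.
  - by move=> j; rewrite !inE => /orP[/eqP->//|/ltJ/ltnW].
apply/seteqP; split=> t /=.
  move=> [[At Bt] Jt]; split=> // j; rewrite !inE /E'; case: eqP => [->//|_ /= jJ].
  exact: Jt.
move=> [At Jt]; split; [split=> //|].
  by have := Jt i; rewrite /E' eqxx; apply; rewrite !inE eqxx.
move=> j jJ; have := Jt j; rewrite /E'; case: eqP => [ji|_]; last first.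
  by apply; rewrite !inE jJ orbT.
by rewrite ji (negbTE iJ) in jJ.
Qed.

Let indep_pastP k : (k <= n)%N -> indep_past k.
Proof.
elim: k => [_|k IHk kn] A J E mA mE geJ.
  have [Ae|Ae] := pselect (A e).
    rewrite (_ : S 0%N @^-1` A = setT); last first.
      by apply/seteqP; split=> // t _ /=; rewrite S0.
    by rewrite setTI probability_setT mul1e indepY.
  rewrite (_ : S 0%N @^-1` A = set0); last first.
    by apply/seteqP; split=> // t /=; rewrite S0.
  by rewrite set0I measure0 mul0e.
pose i := Ordinal kn.
have mG : measurable (op @^-1` A).
  by rewrite -[X in measurable X]setTI; exact: mop.
have SE : S k.+1 @^-1` A = (fun t => (S i t, Y i t)) @^-1` (op @^-1` A).
  by apply/seteqP; split=> t /=; rewrite (SS i).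
have Hi : indep_past i := IHk (ltnW kn).
rewrite SE (indep_past_pair Hi)//; congr (_ * _).
have := indep_past_pair Hi (J := finset.set0) (E := fun=> setT) mG.
rewrite big_set0 mule1 => <-//; last by move=> j; rewrite inE.
by congr (P _); apply/seteqP; split=> [t []//|t Gt]; split=> // j; rewrite inE.
Qed.

(** By induction on k, the event S k in A is independent of every family of
    events on the Y i with k <= i. *)
Lemma partial_sum_law (i : 'I_n) (A : set V) : measurable A ->
  distribution P (S i.+1) A =
  (distribution P (S i) \x distribution P (Y i)) (op @^-1` A).
Proof.
move=> mA.
have mG : measurable (op @^-1` A).
  by rewrite -[X in measurable X]setTI; exact: mop.
have := indep_past_pair (indep_pastP (ltnW (ltn_ord i)))
  (J := finset.set0) (E := fun=> setT) mG.
rewrite big_set0 mule1 => <-//; last by move=> j; rewrite inE.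
rewrite /distribution /pushforward; congr (P _).
apply/seteqP; split=> t /=; rewrite SS; last by case.
by move=> At; split=> // j; rewrite inE.
Qed.

End partial_sums.
End independence.

(** * Convolution of Gaussian and Gamma kernels *)

(** Measurability of an expression by recursion on its syntax. *)
Ltac solve_measurable :=
  lazymatch goal with
  | |- measurable_fun _ (fun _ => ?c) => exact: measurable_cst
  | |- measurable_fun _ (fun x => x) => exact: measurable_id
  | |- measurable_fun _ fst => exact: measurable_fst
  | |- measurable_fun _ snd => exact: measurable_snd
  | |- measurable_fun _ (@expR _) => exact: measurable_expR
  | |- measurable_fun _ (fun x => (@?f x)%:E) =>
      apply/measurable_EFinP; solve_measurable
  | |- measurable_fun _ (fun x => (@?f x, @?g x)) =>
      apply: (@measurable_fun_pair _ _ _ _ _ _ f g); solve_measurable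
  | |- measurable_fun _ (fun x => @GRing.add _ (@?f x) (@?g x)) =>
      apply: (@measurable_funD _ _ _ _ f g); solve_measurable
  | |- measurable_fun _ (fun x => @GRing.mul _ (@?f x) (@?g x)) =>
      apply: (@measurable_funM _ _ _ _ f g); solve_measurable
  | |- measurable_fun _ (fun x => @GRing.opp _ (@?f x)) =>
      apply: (@measurable_funN _ _ _ _ f); solve_measurable
  | |- measurable_fun _ (fun x => @GRing.exp _ (@?f x) ?n) =>
      apply: (@measurable_funX _ _ _ _ f n); solve_measurable
  | |- measurable_fun _ (fun x => expR (@?f x)) =>
      apply: (measurableT_comp (@measurable_expR _) (g := f)); solve_measurable
  | |- measurable_fun _ (fun x => powR (@?f x) ?r) =>
      apply: (measurableT_comp (@measurable_powR _ r) (g := f)); solve_measurable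
  | |- measurable_fun _ (fun x => fst (@?f x)) =>
      apply: (measurableT_comp measurable_fst (g := f)); solve_measurable
  | |- measurable_fun _ (fun x => snd (@?f x)) =>
      apply: (measurableT_comp measurable_snd (g := f)); solve_measurable
  end.

Section gauss_kernel.
Context (R : realType).
Notation RR := (measurableTypeR R).
Notation mu := (@lebesgue_measure R).

(** The centred normal density of variance w, for 0 < w.  Real powers replace
    the square root and the inverse because they are visibly measurable in w. *)
Definition gauss_kernel (w p : R) : R :=
  (2 * pi * w) `^ (- 2^-1) * expR (- (p ^+ 2 * w `^ (- 1)) / 2).

Lemma gauss_kernel_ge0 w p : 0 <= gauss_kernel w p.
Proof. by rewrite mulr_ge0 ?powR_ge0 ?expR_ge0. Qed.

Lemma measurable_gauss_kernel :
  measurable_fun setT (fun z : RR * RR => gauss_kernel z.1 z.2).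
Proof. by rewrite /gauss_kernel; solve_measurable. Qed.

Lemma gauss_kernelE w p : 0 < w ->
  gauss_kernel w p = (Num.sqrt (2 * pi * w))^-1 * expR (- p ^+ 2 / (2 * w)).
Proof.
move=> w0; rewrite /gauss_kernel powRN powR12_sqrt ?mulr_ge0 ?pi_ge0 ?ltW//.
rewrite powR_inv1 ?ltW//; congr (_ * expR _).
by field; rewrite gt_eqF.
Qed.

(** Completing the square: in p', the product is a normal density times the
    convolution at p, so that integrating p' out is immediate. *)
Lemma gauss_kernelM w1 w2 p p' : 0 < w1 -> 0 < w2 ->
  gauss_kernel w1 p' * gauss_kernel w2 (p - p') =
  gauss_kernel (w1 + w2) p *
  normal_pdf (p * w1 / (w1 + w2)) (Num.sqrt (w1 * w2 / (w1 + w2))) p'.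
Proof.
move=> w10 w20; have w120 : 0 < w1 + w2 by exact: addr_gt0.
have v0 : 0 < w1 * w2 / (w1 + w2) by rewrite divr_gt0// mulr_gt0.
rewrite !gauss_kernelE// normal_pdfE ?gt_eqF ?sqrtr_gt0//.
rewrite /normal_peak /normal_fun sqr_sqrtr ?ltW//.
rewrite mulrACA [RHS]mulrACA -!expRD; congr (_ * expR _).
  rewrite -!invfM -!sqrtrM ?mulr_ge0 ?pi_ge0 ?ltW//; congr (Num.sqrt _)^-1.
  by field; rewrite gt_eqF.
by field; rewrite !gt_eqF ?pmulrn_lgt0 ?mulr_gt0.
Qed.

Local Open Scope ereal_scope.

Lemma gauss_kernel_conv w1 w2 p : (0 < w1)%R -> (0 < w2)%R ->
  \int[mu]_p' (gauss_kernel w1 p' * gauss_kernel w2 (p - p'))%:E =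
  (gauss_kernel (w1 + w2) p)%:E.
Proof.
move=> w10 w20; under eq_integral do rewrite gauss_kernelM// EFinM.
rewrite ge0_integralZl_EFin ?gauss_kernel_ge0//.
- by rewrite integral_normal_pdf mule1.
- by move=> x _; rewrite lee_fin normal_pdf_ge0.
- by apply/measurable_EFinP; exact: measurable_normal_pdf.
Qed.

End gauss_kernel.

Lemma mulr_powRB1 (R : realType) (a w : R) : 0 < w -> w * w `^ (a - 1) = w `^ a.
Proof.
move=> w0; rewrite -[X in X * _](powRr1 (ltW w0)) -powRD.
  by congr (_ `^ _); ring.
by rewrite (gt_eqF w0) implybT.
Qed.

Section gamma_kernel.
Context (R : realType).
Notation RR := (measurableTypeR R).
Notation mu := (@lebesgue_measure R).

(** Unnormalised Gamma density of shape a and rate 1/2, and unnormalised Beta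
    density. *)
Definition gamma_kernel (a w : R) : R :=
  \1_(`]0, +oo[%classic : set R) w * (w `^ (a - 1) * expR (- w / 2)).

Definition beta_kernel (a b t : R) : R :=
  \1_(`]0, 1[%classic : set R) t * (t `^ (a - 1) * (1 - t) `^ (b - 1)).

Lemma gamma_kernel_ge0 a w : 0 <= gamma_kernel a w.
Proof. by rewrite !mulr_ge0 ?powR_ge0 ?expR_ge0. Qed.

Lemma beta_kernel_ge0 a b t : 0 <= beta_kernel a b t.
Proof. by rewrite !mulr_ge0 ?powR_ge0. Qed.

Lemma gamma_kernelE a w : 0 < w ->
  gamma_kernel a w = w `^ (a - 1) * expR (- w / 2).
Proof.
by move=> w0; rewrite /gamma_kernel indicE mem_set ?mul1r//= in_itv/= w0.
Qed.

Lemma gamma_kernel0 a w : w <= 0 -> gamma_kernel a w = 0.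
Proof.
move=> w0; rewrite /gamma_kernel indicE memNset ?mul0r//= in_itv/= andbT.
by apply/negP; rewrite -leNgt.
Qed.

Lemma measurable_gamma_kernel a : measurable_fun setT (gamma_kernel a : RR -> R).
Proof.
apply: measurable_funM; first exact: measurable_indic.
by solve_measurable.
Qed.

Lemma measurable_beta_kernel a b : measurable_fun setT (beta_kernel a b : RR -> R).
Proof.
apply: measurable_funM; first exact: measurable_indic.
by solve_measurable.
Qed.

Lemma gamma_kernel_scale a b w t : 0 < w ->
  gamma_kernel a (w * t) * gamma_kernel b (w - w * t) =
  w `^ (a + b - 2) * expR (- w / 2) * beta_kernel a b t.
Proof.
move=> w0; rewrite /beta_kernel indicE.
have [t0|t0] := leP t 0.
  rewrite gamma_kernel0 ?pmulr_rle0// memNset ?mul0r ?mulr0//=.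
  by rewrite in_itv/= => /andP[]; rewrite ltNge t0.
have [t1|t1] := leP 1 t.
  rewrite mulrC gamma_kernel0 ?memNset ?mul0r ?mulr0//=.
    by rewrite in_itv/= => /andP[_]; rewrite ltNge t1.
  by rewrite subr_le0 ler_peMr// ltW.
rewrite mem_set/= ?in_itv/= ?t0// mul1r.
have t1' : 0 < 1 - t by rewrite subr_gt0.
rewrite -[X in X - _]mulr1 -mulrBr !gamma_kernelE ?mulr_gt0//.
rewrite !powRM ?ltW// (_ : a + b - 2 = (a - 1) + (b - 1)); last by ring.
rewrite [w `^ (_ + (b - 1))]powRD ?(gt_eqF w0) ?implybT//.
rewrite (_ : - w / 2 = - (w * t) / 2 + (- (w * (1 - t)) / 2)); last by field.
by rewrite expRD; ring.
Qed.

Local Open Scope ereal_scope.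

(** Homogeneity: v = w t makes w factor out.  The Beta integral is left
    unevaluated, and may a priori be infinite. *)
Lemma gamma_kernel_conv a b w :
  \int[mu]_v (gamma_kernel a v * gamma_kernel b (w - v))%:E =
  (gamma_kernel (a + b) w)%:E * \int[mu]_t (beta_kernel a b t)%:E.
Proof.
have [w0|w0] := leP w 0%R.
  rewrite gamma_kernel0// mul0e integral0_eq// => v _.
  have [v0|v0] := leP v 0%R; first by rewrite gamma_kernel0// mul0r.
  by rewrite [X in (_ * X)%R]gamma_kernel0 ?mulr0// subr_le0 (le_trans w0)// ltW.
have mF : measurable_fun setT
    (fun v : RR => (gamma_kernel a v * gamma_kernel b (w - v))%:E).
  apply/measurable_EFinP/measurable_funM; first exact: measurable_gamma_kernel.
  apply: (measurableT_comp (measurable_gamma_kernel b)).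
  by solve_measurable.
rewrite (@ge0_integral_affine R w 0) ?gt_eqF//; last first.
  by move=> v; rewrite lee_fin mulr_ge0 ?gamma_kernel_ge0.
under eq_integral do rewrite addr0 gamma_kernel_scale// EFinM.
rewrite ge0_integralZl_EFin ?mulr_ge0 ?powR_ge0 ?expR_ge0//.
- rewrite muleA -EFinM gamma_kernelE// gtr0_norm// mulrA; congr (_%:E * _).
  congr (_ * _)%R; rewrite (_ : a + b - 2 = (a + b - 1) - 1)%R; last by ring.
  by rewrite mulr_powRB1.
- by move=> t _; rewrite lee_fin beta_kernel_ge0.
- by apply/measurable_EFinP; exact: measurable_beta_kernel.
Qed.

End gamma_kernel.

(** * The normal variance mixture *)

(** The kernels have to be recognized before [mulr_ge0], which would unfold
    them. *)
Ltac kernel_ge0 := rewrite ?lee_fin; repeat first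
  [ exact: gamma_kernel_ge0 | exact: gauss_kernel_ge0 | exact: beta_kernel_ge0
  | apply: mulr_ge0 ].

Section mixture.
Context (R : realType).
Notation RR := (measurableTypeR R).
Notation R3 := (RR * RR * RR)%type.
Notation mu := (@lebesgue_measure R).
Notation mu2 := (lebesgue2 R).
Notation mu3 := (lebesgue3 R).

(** Up to a constant, the joint density of (sqrt w X, sqrt w Y, w) for X and Y
    standard normal and w of Gamma law with shape a and rate 1/2, all
    independent. *)
Definition mixture (a : R) (z : R3) : R :=
  gamma_kernel a z.2 * (gauss_kernel z.2 z.1.1 * gauss_kernel z.2 z.1.2).

Definition add3 (u : R3 * R3) : R3 :=
  (u.1.1.1 + u.2.1.1, u.1.1.2 + u.2.1.2, u.1.2 + u.2.2).

Definition sub3 (u : R3 * R3) : R3 :=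
  (u.1.1.1 - u.2.1.1, u.1.1.2 - u.2.1.2, u.1.2 - u.2.2).

Lemma measurable_add3 : measurable_fun setT add3.
Proof. by rewrite /add3; solve_measurable. Qed.

Lemma measurable_sub3 : measurable_fun setT sub3.
Proof. by rewrite /sub3; solve_measurable. Qed.

Lemma mixture_ge0 a z : 0 <= mixture a z.
Proof. by rewrite /mixture; kernel_ge0. Qed.

Lemma measurable_mixture a : measurable_fun setT (mixture a).
Proof.
apply: measurable_funM.
  exact: (measurableT_comp (measurable_gamma_kernel a) measurable_snd).
apply: measurable_funM.
  apply: (measurableT_comp (@measurable_gauss_kernel R)
    (g := fun z : R3 => (z.2, z.1.1))).
  by solve_measurable.
apply: (measurableT_comp (@measurable_gauss_kernel R)
    (g := fun z : R3 => (z.2, z.1.2))).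
by solve_measurable.
Qed.

Local Open Scope ereal_scope.

Lemma measurable_gauss_kernelT (w : R) d (T : measurableType d) (f : T -> RR) :
  measurable_fun setT f -> measurable_fun setT (fun x => gauss_kernel w (f x)).
Proof.
move=> mf; apply: (measurableT_comp (@measurable_gauss_kernel R)
  (g := fun x => (w, f x))).
exact: measurable_fun_pair.
Qed.

Lemma gauss_kernel2_conv w1 w2 p q : (0 < w1)%R -> (0 < w2)%R ->
  \int[mu2]_z (gauss_kernel w1 z.1 * gauss_kernel w1 z.2 *
     (gauss_kernel w2 (p - z.1) * gauss_kernel w2 (q - z.2)))%:E =
  (gauss_kernel (w1 + w2) p * gauss_kernel (w1 + w2) q)%:E.
Proof.
move=> w10 w20.
rewrite lebesgue2_tonelli; last 2 first.
- apply/measurable_EFinP; do 2 (apply: measurable_funM); apply: measurable_gauss_kernelT;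
  by solve_measurable.
- by move=> z; kernel_ge0.
transitivity (\int[mu]_x ((gauss_kernel (w1 + w2) q)%:E *
    (gauss_kernel w1 x * gauss_kernel w2 (p - x))%:E)).
  apply: eq_integral => x _ /=; under eq_integral do rewrite mulrACA EFinM.
  rewrite ge0_integralZl_EFin//; last by kernel_ge0.
  - by rewrite gauss_kernel_conv// muleC.
  - by move=> y _; kernel_ge0.
  - by apply/measurable_EFinP/measurable_funM; apply: measurable_gauss_kernelT; solve_measurable.
rewrite ge0_integralZl_EFin//; last by kernel_ge0.
- by rewrite gauss_kernel_conv// -EFinM mulrC.
- by move=> y _; kernel_ge0.
- by apply/measurable_EFinP/measurable_funM; apply: measurable_gauss_kernelT; solve_measurable.
Qed.

(** For mixing variables v and z.2 - v the Gaussian factors convolve to the ones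
    of variance z.2, whatever v is; the Gamma factors are then convolved. *)
Lemma mixture_conv a b z :
  \int[mu3]_s (mixture a s * mixture b (sub3 (z, s)))%:E =
  (mixture (a + b) z)%:E * \int[mu]_t (beta_kernel a b t)%:E.
Proof.
have msub : measurable_fun setT (fun s => sub3 (z, s)).
  by rewrite /sub3; solve_measurable.
rewrite lebesgue3_tonelli; last 2 first.
- apply/measurable_EFinP/measurable_funM; first exact: measurable_mixture.
  exact: (measurableT_comp (measurable_mixture b) msub).
- by move=> s; rewrite lee_fin mulr_ge0 ?mixture_ge0.
pose G := (gauss_kernel z.2 z.1.1 * gauss_kernel z.2 z.1.2)%R.
transitivity (\int[mu]_v (G%:E *
    (gamma_kernel a v * gamma_kernel b (z.2 - v))%:E)).
  apply: eq_integral => v _; rewrite /mixture/=.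
  have [v0|v0] := leP v 0%R.
    rewrite gamma_kernel0// mul0r mule0 integral0_eq// => x _.
    by rewrite /= !mul0r.
  have [zv|zv] := leP (z.2 - v)%R 0%R.
    rewrite [gamma_kernel b _]gamma_kernel0// mulr0 mule0 integral0_eq// => x _.
    by rewrite /= mul0r mulr0.
  under eq_integral do rewrite mulrACA EFinM.
  rewrite ge0_integralZl_EFin//; last by kernel_ge0.
  - by rewrite gauss_kernel2_conv// muleC /G [(v + _)%R]addrC subrK.
  - by move=> y _; kernel_ge0.
  - apply/measurable_EFinP; do 2 (apply: measurable_funM);
      apply: measurable_gauss_kernelT; by solve_measurable.
rewrite ge0_integralZl_EFin; last 4 first.
- by [].
- by move=> v _; kernel_ge0.
- apply/measurable_EFinP/measurable_funM; first exact: measurable_gamma_kernel.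
  by apply: (measurableT_comp (measurable_gamma_kernel b)); solve_measurable.
- by kernel_ge0.
by rewrite gamma_kernel_conv muleA -EFinM mulrC.
Qed.

End mixture.

Section mixture_law.
Context (R : realType).
Notation RR := (measurableTypeR R).
Notation R3 := (RR * RR * RR)%type.
Notation mu := (@lebesgue_measure R).
Notation mu3 := (lebesgue3 R).
Local Open Scope ereal_scope.

Lemma lebesgue33_tonelli_swap (F : R3 * R3 -> \bar R) :
    measurable_fun setT F -> (forall x, 0 <= F x) ->
  \int[mu3]_s \int[mu3]_z F (s, z) = \int[mu3]_z \int[mu3]_s F (s, z).
Proof.
move=> mF F0.
exact: (@fubini_tonelli _ _ _ _ _ (sigma_finite_lebesgue3 R)
  (sigma_finite_lebesgue3 R) F mF F0).
Qed.

Lemma measurable_integral_lebesgue3 (F : R3 * R3 -> \bar R) :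
    measurable_fun setT F -> (forall x, 0 <= F x) ->
  measurable_fun setT (fun s => \int[mu3]_z F (s, z)).
Proof.
exact: (@measurable_fun_fubini_tonelli_F _ _ _ _ _ (sigma_finite_lebesgue3 R)).
Qed.

(** Tonelli and translation invariance: the density of a sum is the convolution
    of the densities. *)
Lemma sum_density (nu1 nu2 : probability R3 R) (f1 f2 : R3 -> R) (A : set R3) :
    measurable_fun setT f1 -> (forall z, 0 <= f1 z)%R ->
    measurable_fun setT f2 -> (forall z, 0 <= f2 z)%R ->
    (forall A, measurable A -> nu1 A = \int[mu3]_(z in A) (f1 z)%:E) ->
    (forall A, measurable A -> nu2 A = \int[mu3]_(z in A) (f2 z)%:E) ->
    measurable A ->
  (nu1 \x nu2) (@add3 R @^-1` A) =
  \int[mu3]_(z in A) \int[mu3]_s (f1 s * f2 (sub3 (z, s)))%:E.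
Proof.
move=> mf1 f10 mf2 f20 nu1E nu2E mA.
have madd : measurable_fun setT (@add3 R) by exact: measurable_add3.
have mG : measurable (@add3 R @^-1` A).
  by rewrite -[X in measurable X]setTI; have madd' := madd; exact: madd'.
have m1A : measurable_fun setT (\1_A : R3 -> R) by exact: measurable_indic.
pose K (u : R3 * R3) := (f2 (sub3 (u.2, u.1)) * \1_A u.2)%:E.
have mK : measurable_fun setT K.
  apply/measurable_EFinP/measurable_funM.
    apply: (measurableT_comp mf2); apply: (measurableT_comp (@measurable_sub3 R)
      (g := fun u => (u.2, u.1))).
    by apply: measurable_fun_pair.
  exact: (measurableT_comp m1A measurable_snd).
have K0 u : 0 <= K u by rewrite lee_fin mulr_ge0.
have sectionE s : nu2 (xsection (@add3 R @^-1` A) s) = \int[mu3]_z K (s, z).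
  rewrite nu2E; last exact: measurable_xsection.
  rewrite -(@ge0_integral_shift3 R s.1.1 s.1.2 s.2 (fun z => K (s, z)))//; last first.
    exact: (measurableT_comp mK (pair1_measurable s)).
  rewrite integral_mkcond; apply: eq_integral => y _.
  have addE : add3 (s, y) = (y.1.1 + s.1.1, y.1.2 + s.1.2, y.2 + s.2)%R.
    by rewrite /add3/= ![(s.1.1 + _)%R]addrC ![(s.1.2 + _)%R]addrC ![(s.2 + _)%R]addrC.
  have -> : K (s, (y.1.1 + s.1.1, y.1.2 + s.1.2, y.2 + s.2)%R) =
      (f2 y * \1_A (add3 (s, y)))%:E.
    rewrite addE /K/= /sub3/= !addrK; congr (f2 _ * _)%:E.
    by case: y {addE} => [[]].
  rewrite patchE indicE; case: ifPn => [/set_mem/mem_set|] yA.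
    by rewrite inE in yA; rewrite mem_set ?mulr1//; apply/xsectionP.
  rewrite memNset ?mulr0// => yA'; move: yA; rewrite notin_setE; apply.
  by apply/xsectionP.
rewrite /product_measure1 /=.
transitivity (\int[nu1]_s \int[mu3]_z K (s, z)).
  by apply: eq_integral => s _ /=; exact: sectionE.
rewrite (ge0_integral_density (mu := mu3) mf1 f10)//; last 2 first.
- exact: measurable_integral_lebesgue3.
- by move=> s; exact: integral_ge0.
transitivity (\int[mu3]_s \int[mu3]_z ((f1 s)%:E * K (s, z))).
  apply: eq_integral => s _; rewrite ge0_integralZl_EFin//.
  exact: (measurableT_comp mK (pair1_measurable s)).
rewrite (lebesgue33_tonelli_swap (F := fun u => (f1 u.1)%:E * K u)); last 2 first.
- apply: emeasurable_funM => //; apply/measurable_EFinP.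
  exact: (measurableT_comp mf1 measurable_fst).
- by move=> u; rewrite mule_ge0// lee_fin.
rewrite [RHS]integral_mkcond; apply: eq_integral => z _.
rewrite patchE /K /= indicE; case: ifPn => zA.
  by apply: eq_integral => s _; rewrite mulr1.
by rewrite integral0_eq// => s _; rewrite mulr0 mule0.
Qed.

Definition has_mixture_law (nu : set R3 -> \bar R) (a : R) :=
  exists2 c, (0 <= c)%R &
    forall A, measurable A -> nu A = \int[mu3]_(z in A) (c * mixture a z)%:E.

(** The constants only have to exist, since the total mass of a law determines
    its constant. *)
Lemma mixture_law_conv (nu1 nu2 : probability R3 R) a b :
    has_mixture_law nu1 a -> has_mixture_law nu2 b ->
  has_mixture_law (fun A => (nu1 \x nu2) (@add3 R @^-1` A)) (a + b).
Proof.
move=> [c1 c10 nu1E] [c2 c20 nu2E].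
pose B := \int[mu]_t (beta_kernel a b t)%:E.
have B0 : 0 <= B by apply: integral_ge0 => t _; rewrite lee_fin beta_kernel_ge0.
have mmix (c e : R) : measurable_fun setT (fun z => c * mixture e z)%R.
  by apply: measurable_funM => //; exact: measurable_mixture.
have mix0 (c e : R) z : (0 <= c -> 0 <= c * mixture e z)%R.
  by move=> c0; rewrite mulr_ge0// mixture_ge0.
have lawE A : measurable A -> (nu1 \x nu2) (@add3 R @^-1` A) =
    B * \int[mu3]_(z in A) (c1 * c2 * mixture (a + b) z)%:E.
  move=> mA.
  rewrite (@sum_density _ _ (fun z => c1 * mixture a z)%R
    (fun z => c2 * mixture b z)%R)//; try by move=> z; exact: mix0.
  rewrite -ge0_integralZl//; last 2 first.
  - by apply: measurable_funTS; apply/measurable_EFinP; exact: mmix.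
  - by move=> z _; rewrite lee_fin mix0 ?mulr_ge0.
  apply: eq_integral => z _; under eq_integral do rewrite mulrACA EFinM.
  rewrite ge0_integralZl_EFin ?mulr_ge0//.
  - by rewrite mixture_conv muleA -EFinM muleC.
  - by move=> s _; rewrite lee_fin mulr_ge0 ?mixture_ge0.
  - apply/measurable_EFinP/measurable_funM; first exact: measurable_mixture.
    apply: (measurableT_comp (measurable_mixture b)).
    by rewrite /sub3; solve_measurable.
(* An infinite Beta integral would give total mass 0 or +oo. *)
have Bfin : B \is a fin_num.
  rewrite fin_numE; apply/andP; split; first by rewrite gt_eqF// (lt_le_trans _ B0).
  apply/negP => /eqP Boo.
  have := lawE setT measurableT; rewrite preimage_setT probability_setT Boo.
  set I := integral _ _ _; have : 0 <= I.
    by apply: integral_ge0 => z _; rewrite lee_fin mix0 ?mulr_ge0.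
  rewrite le_eqVlt => /predU1P[<-|I0].
    by rewrite mule0 => /eqP; rewrite onee_eq0.
  by rewrite gt0_mulye.
exists (fine B * (c1 * c2))%R; first by rewrite !mulr_ge0// fine_ge0.
move=> A mA; rewrite lawE// -{1}(fineK Bfin) -ge0_integralZl_EFin ?fine_ge0//.
- by apply: eq_integral => z _; rewrite -EFinM mulrA.
- by move=> z _; rewrite lee_fin mix0 ?mulr_ge0.
- by apply: measurable_funTS; apply/measurable_EFinP; exact: mmix.
Qed.

End mixture_law.

(** * The covariance matrix *)

Section Sigma_matrix.
Context (R : realType) (rho sigma : R).
Hypotheses (hsigma : 0 < 1 - sigma) (hrho : 0 < 1 - 2 * rho ^+ 2 + sigma).
Let xi := 1 - 2 * rho ^+ 2 + sigma.

Lemma det_Sigma : \det (Sigma rho sigma) = (1 - sigma) * xi.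
Proof.
rewrite (expand_det_row _ ord0) !big_ord_recl big_ord0 /cofactor.
rewrite !(expand_det_row _ ord0) !big_ord_recl !big_ord0 /cofactor !det_mx11.
rewrite !mxE /= /bump /=.
by rewrite /xi; ring.
Qed.

(** The quadratic form U^2 + V^2 + C^2, where U = (A + B - 2 rho C) / sqrt (2 xi)
    and V = (A - B) / sqrt (2 (1 - sigma)), as a sum of three squares. *)
Definition Sigma_inv : 'M[R]_3 :=
  let u := \row_(j < 3) nth 0 [:: 1; 1; - (2 * rho)] j in
  let v := \row_(j < 3) nth 0 [:: 1; - 1; 0] j in
  let e := \row_(j < 3) nth 0 [:: 0; 0; 1] j in
  (2 * xi)^-1 *: (u^T *m u) + (2 * (1 - sigma))^-1 *: (v^T *m v) + e^T *m e.

Lemma Sigma_invP : Sigma rho sigma *m Sigma_inv = 1%:M.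
Proof.
apply/matrixP => i j; rewrite !mxE !big_ord_recl big_ord0 !mxE !big_ord_recl !big_ord0 !mxE.
case: i => [[|[|[|//]]]] ? /=; case: j => [[|[|[|//]]]] ? /=; rewrite /bump /= /xi;
  by field; rewrite !gt_eqF.
Qed.

Lemma invmx_Sigma : invmx (Sigma rho sigma) = Sigma_inv.
Proof.
have [uS _] := mulmx1_unit Sigma_invP.
by rewrite -[RHS](mulKmx uS) Sigma_invP mulmx1.
Qed.

Lemma mvnormal_pdf_Sigma (p : R * R * R) :
  mvnormal_pdf 0 (Sigma rho sigma) (row3 p) =
  (Num.sqrt ((2 * pi) ^+ 3 * ((1 - sigma) * xi)))^-1 *
  expR (- ((p.1.1 + p.1.2 - 2 * rho * p.2) ^+ 2 / (2 * xi) +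
           (p.1.1 - p.1.2) ^+ 2 / (2 * (1 - sigma)) + p.2 ^+ 2) / 2).
Proof.
rewrite /mvnormal_pdf det_Sigma invmx_Sigma subr0; congr (_ * expR (- _ / 2)).
rewrite !mxE !big_ord_recl big_ord0 !mxE !big_ord_recl !big_ord0.
rewrite !mxE !big_ord_recl !big_ord0 !mxE /= /bump /= /xi.
by field; rewrite !gt_eqF.
Qed.

End Sigma_matrix.

(** * Reflection and squaring on the line *)

Section even_and_square.
Context (R : realType).
Notation RR := (measurableTypeR R).
Notation mu := (@lebesgue_measure R).
Local Open Scope ereal_scope.

Lemma ge0_integral_reflect (F : RR -> \bar R) :
    measurable_fun setT F -> (forall x, 0 <= F x) ->
  \int[mu]_x F x = \int[mu]_(x in `]0%R, +oo[) (F x + F (- x)%R).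
Proof.
move=> mF F0.
have mN : measurable_fun setT (fun x : RR => F (- x)%R).
  by apply: (measurableT_comp mF (g := fun x : RR => - x)%R); solve_measurable.
have m0 : measurable (`]-oo, 0%R]%classic : set RR) by exact: measurable_itv.
have m0' : measurable (`]0%R, +oo[%classic : set RR) by exact: measurable_itv.
rewrite ge0_integralD//; last 2 first.
- exact: measurable_funTS.
- exact: measurable_funTS.
rewrite (_ : [set: RR] = `]-oo, 0%R]%classic `|` `]0%R, +oo[%classic); last first.
  by apply/seteqP; split=> // x _ /=; rewrite !in_itv/= andbT; case: (leP x 0%R); auto.
rewrite ge0_integral_setU//; last 2 first.
- by rewrite -setCitvr setvU.
- by apply/disj_setPLR => x /=; rewrite !in_itv/= andbT => x0 /=; apply/negP; rewrite -leNgt.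
rewrite addeC; congr (_ + _).
rewrite integral_itv_obnd_cbnd; last exact: measurable_funTS.
rewrite ge0_integration_by_substitution0//.
by apply: eq_integral => x _; rewrite opprK.
Qed.

(** On the positive half-line, x = exp t and w = exp (2 t) reduce the squaring
    substitution to a doubling of t, whose factor 2 is matched by the two signs
    of x. *)
Lemma ge0_integral_square (G : RR -> \bar R) :
    measurable_fun setT G -> (forall x, 0 <= G x) ->
  \int[mu]_x G (x ^+ 2)%R =
  \int[mu]_(w in `]0%R, +oo[) ((w `^ (2^-1 - 1))%:E * G w).
Proof.
move=> mG G0.
have mG2 : measurable_fun setT (fun x : RR => G (x ^+ 2)%R).
  by apply: (measurableT_comp mG (g := fun x : RR => x ^+ 2)%R); solve_measurable.
have mGe (c : R) : measurable_fun setT (fun t : RR => G (expR (c * t))%R).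
  by apply: (measurableT_comp mG (g := fun t : RR => expR (c * t))%R); solve_measurable.
rewrite ge0_integral_reflect//.
transitivity (\int[mu]_(x in `]0%R, +oo[) (2%:E * G (x ^+ 2)%R)).
  by apply: eq_integral => x _; rewrite sqrrN mule_natl mule2n.
rewrite !ge0_integral_expR//; last 4 first.
- apply: emeasurable_funM => //; apply/measurable_EFinP.
  exact: measurable_powR.
- by move=> w; rewrite mule_ge0// lee_fin powR_ge0.
- by apply: emeasurable_funM => //; exact: measurable_cst.
- by move=> w; rewrite mule_ge0// lee_fin.
have mE : measurable_fun setT (fun t : RR =>
    (expR t)%:E * ((expR t `^ (2^-1 - 1))%:E * G (expR t))).
  apply: emeasurable_funM; first by solve_measurable.
  apply: emeasurable_funM; first by solve_measurable.
  by have := mGe 1%R; under eq_fun do rewrite mul1r.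
rewrite [RHS](@ge0_integral_affine R 2 0)//; last first.
  by move=> t; rewrite !mule_ge0 ?lee_fin ?expR_ge0 ?powR_ge0.
rewrite -[RHS]ge0_integralZl_EFin; last 4 first.
- exact: measurableT.
- by move=> t _; rewrite !mule_ge0 ?lee_fin ?expR_ge0 ?powR_ge0.
- apply: (measurableT_comp mE (g := fun t : RR => 2 * t + 0)%R).
  by solve_measurable.
- exact: normr_ge0.
apply: eq_integral => t _; rewrite addr0 ger0_norm//.
rewrite expRM_natl !muleA -!EFinM; congr (_%:E * _).
rewrite -expRM_natl -expRM -mulrA -expRD mulrC; congr (_ * expR _)%R.
by field.
Qed.

End even_and_square.

(** * One observation *)

Section single_observation.
Context (R : realType) (rho sigma : R).
Hypotheses (hsigma : 0 < 1 - sigma) (hrho : 0 < 1 - 2 * rho ^+ 2 + sigma).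
Notation RR := (measurableTypeR R).
Notation R3 := (RR * RR * RR)%type.
Notation mu := (@lebesgue_measure R).
Notation mu2 := (lebesgue2 R).
Notation mu3 := (lebesgue3 R).
Let xi := 1 - 2 * rho ^+ 2 + sigma.
Let s1 := Num.sqrt (2 * xi).
Let s2 := Num.sqrt (2 * (1 - sigma)).

(** (U C, V C, C^2) as a function of (A, B, C). *)
Definition product_triple (p : R3) : R3 :=
  ((p.1.1 + p.1.2 - 2 * rho * p.2) / Num.sqrt (2 * (1 - 2 * rho ^+ 2 + sigma))
     * p.2,
   (p.1.1 - p.1.2) / Num.sqrt (2 * (1 - sigma)) * p.2,
   p.2 ^+ 2).

Lemma measurable_product_triple : measurable_fun setT product_triple.
Proof. by rewrite /product_triple; solve_measurable. Qed.

Let s10 : 0 < s1. Proof. by rewrite sqrtr_gt0 mulr_gt0. Qed.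
Let s20 : 0 < s2. Proof. by rewrite sqrtr_gt0 mulr_gt0. Qed.

(** The density of (U C, V C) times that of C at C = c, restricted to the event
    that (U C, V C, C^2) lies in E. *)
Let slice (c : R) (E : set R3) (z : RR * RR) :=
  (Num.sqrt (2 * pi))^-1 * expR (- c ^+ 2 / 2) *
  (gauss_kernel (c ^+ 2) z.1 * gauss_kernel (c ^+ 2) z.2 * \1_E (z, c ^+ 2)).

Let normal_slice (c : R) (E : set R3) (z : RR * RR) : c != 0 ->
  mvnormal_pdf 0 (Sigma rho sigma) (row3 (z, c)) * \1_E (product_triple (z, c)) =
  2 / `|s1 / c * (s2 / c)| *
  slice c E ((z.1 + z.2 - 2 * rho * c) / (s1 / c), (z.1 - z.2) / (s2 / c)).
Proof.
move=> c0; have c20 : 0 < c ^+ 2 by rewrite exprn_even_gt0.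
have pi0 := pi_gt0 R.
rewrite mvnormal_pdf_Sigma// /slice /=.
set U := z.1 + z.2 - 2 * rho * c; set V := z.1 - z.2.
have -> : product_triple (z, c) = (U / (s1 / c), V / (s2 / c), c ^+ 2).
  rewrite /product_triple /=; congr (_, _, _).
  + by rewrite -/U -/xi -/s1 invf_div mulrA mulrAC.
  + by rewrite -/V -/s2 invf_div mulrA mulrAC.
rewrite [X in _ = _ * X]mulrA [RHS]mulrA; congr (_ * _).
rewrite !gauss_kernelE//.
have s1E : s1 ^+ 2 = 2 * xi by rewrite sqr_sqrtr// mulr_ge0// ltW.
have s2E : s2 ^+ 2 = 2 * (1 - sigma) by rewrite sqr_sqrtr// mulr_ge0// ltW.
set r := Num.sqrt (2 * pi).
have r0 : 0 < r by rewrite sqrtr_gt0 mulr_gt0.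
have rE : r ^+ 2 = 2 * pi by rewrite sqr_sqrtr// mulr_ge0// ltW.
have -> : Num.sqrt ((2 * pi) ^+ 3 * ((1 - sigma) * xi)) = r ^+ 3 * (s1 * s2) / 2.
  rewrite -[RHS]gtr0_norm; last by rewrite divr_gt0// !mulr_gt0// exprn_gt0.
  rewrite -sqrtr_sqr; congr Num.sqrt.
  rewrite -[RHS]/((r ^+ 3 * (s1 * s2) / 2) ^+ 2) !exprMn s1E s2E !rE.
  by field.
have -> : Num.sqrt (2 * pi * c ^+ 2) = r * `|c|.
  by rewrite sqrtrM ?sqrtr_sqr// mulr_ge0// ltW.
have -> : `|s1 / c * (s2 / c)| = s1 * s2 / c ^+ 2.
  by rewrite mulf_div -expr2 ger0_norm// divr_ge0 ?(ltW c20)// mulr_ge0// ltW.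
have -> : (U / (s1 / c)) ^+ 2 = U ^+ 2 * c ^+ 2 / (2 * xi).
  by rewrite invf_div !exprMn exprVn s1E mulrA.
have -> : (V / (s2 / c)) ^+ 2 = V ^+ 2 * c ^+ 2 / (2 * (1 - sigma)).
  by rewrite invf_div !exprMn exprVn s2E mulrA.
rewrite [X in _ = _ * (_ * X)]mulrACA -expRD.
rewrite [X in _ = _ * X]mulrACA -expRD [RHS]mulrA.
congr (_ * expR _); last by rewrite /xi; field; rewrite c0 !gt_eqF.
have -> : (r * `|c|)^-1 / (r * `|c|) = (2 * pi * c ^+ 2)^-1.
  by rewrite -invfM -expr2 exprMn rE real_normK ?num_real.
rewrite exprS rE; move: pi0; move: (pi : R) => p p0.
by field; rewrite c0 (gt_eqF p0) (gt_eqF s10) (gt_eqF s20) (gt_eqF r0).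
Qed.

Local Open Scope ereal_scope.

Let measurable_slice (E : set R3) (c : R) : measurable E ->
  measurable_fun setT (slice c E : RR * RR -> R).
Proof.
move=> mE; apply: measurable_funM => //; apply: measurable_funM.
  by apply: measurable_funM; apply: measurable_gauss_kernelT; solve_measurable.
apply: (measurableT_comp (measurable_indic mE) (g := fun z => (z, (c ^+ 2)%R))).
by solve_measurable.
Qed.

Let slice_ge0 c E z : (0 <= slice c E z)%R.
Proof. by rewrite /slice !mulr_ge0 ?invr_ge0 ?expR_ge0 ?powR_ge0. Qed.

Let measurable_normal : measurable_fun setT
  (fun p : R3 => mvnormal_pdf 0 (Sigma rho sigma) (row3 p)).
Proof.
rewrite (_ : (fun p : R3 => _) = (fun p : R3 =>
  (Num.sqrt ((2 * pi) ^+ 3 * ((1 - sigma) * xi)))^-1 *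
  expR (- ((p.1.1 + p.1.2 - 2 * rho * p.2) ^+ 2 / (2 * xi) +
           (p.1.1 - p.1.2) ^+ 2 / (2 * (1 - sigma)) + p.2 ^+ 2) / 2))%R).
  by solve_measurable.
by apply/funext => p; rewrite mvnormal_pdf_Sigma.
Qed.

(** At fixed c <> 0, (a, b) is replaced by (u c, v c), which are independent of
    variance c^2; then c is replaced by w = c^2, a chi-square variable with one
    degree of freedom. *)
Lemma product_triple_law (E : set R3) : measurable E ->
  \int[mu3]_(p in product_triple @^-1` E)
    (mvnormal_pdf 0 (Sigma rho sigma) (row3 p))%:E =
  \int[mu3]_(z in E) ((Num.sqrt (2 * pi))^-1 * mixture 2^-1 z)%:E.
Proof.
move=> mE.
have mpt := measurable_product_triple.
have m1E : measurable_fun setT (\1_E : R3 -> R) by exact: measurable_indic.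
pose f (p : R3) := (mvnormal_pdf 0 (Sigma rho sigma) (row3 p) * \1_E (product_triple p))%R.
have mf : measurable_fun setT (EFin \o f).
  apply/measurable_EFinP/measurable_funM; last exact: (measurableT_comp m1E mpt).
  exact: measurable_normal.
have f0 p : (0 <= f p)%R.
  by rewrite mulr_ge0// mvnormal_pdf_Sigma// mulr_ge0 ?expR_ge0// invr_ge0.
pose Phi (w : RR) := \int[mu2]_z ((Num.sqrt (2 * pi))^-1 * expR (- w / 2) *
  (gauss_kernel w z.1 * gauss_kernel w z.2 * \1_E (z, w)))%:E.
transitivity (\int[mu3]_p (f p)%:E).
  rewrite integral_mkcond; apply: eq_integral => p _.
  by rewrite patchE /f indicE; case: ifPn => pE;
    [rewrite mem_set ?mulr1//; rewrite inE in pE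
    |rewrite memNset ?mulr0//; rewrite notin_setE in pE].
rewrite (lebesgue3_tonelli mf); last by move=> p; rewrite lee_fin.
pose h (u : RR * RR * RR) := ((Num.sqrt (2 * pi))^-1 * expR (- u.2 / 2) *
  (gauss_kernel u.2 u.1.1 * gauss_kernel u.2 u.1.2 * \1_E u))%:E.
have mh : measurable_fun setT h.
  apply/measurable_EFinP/measurable_funM; first by solve_measurable.
  apply: measurable_funM => //; apply: measurable_funM.
    apply: (measurableT_comp (@measurable_gauss_kernel R)
      (g := fun z : R3 => (z.2, z.1.1))).
    by solve_measurable.
  apply: (measurableT_comp (@measurable_gauss_kernel R)
    (g := fun z : R3 => (z.2, z.1.2))).
  by solve_measurable.
have h0 u : 0 <= h u.
  by rewrite lee_fin !mulr_ge0 ?invr_ge0 ?expR_ge0 ?powR_ge0.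
have mPhi : measurable_fun setT Phi.
  rewrite (_ : Phi = fun w => \int[mu2]_z h (z, w)).
    exact: measurable_integral_lebesgue2.
  by apply/funext => w; apply: eq_integral => -[].
have Phi0 w : 0 <= Phi w by apply: integral_ge0 => z _; exact: (h0 (z, w)).
transitivity (\int[mu]_c Phi (c ^+ 2)%R).
  apply: ge0_ae_eq_integral => //.
  - exact: (measurable_integral_lebesgue2 mf).
  - apply: (measurableT_comp mPhi (g := fun c : RR => c ^+ 2)%R).
    by solve_measurable.
  - by move=> c _; apply: integral_ge0 => z _; rewrite lee_fin.
  (* The substitution at fixed c degenerates at c = 0 only. *)
  exists [set 0%R]; split => //=; first exact: lebesgue_measure_set1.
  move=> c /=; apply: contra_notP => /eqP c0 _.
  transitivity (\int[mu2]_z (slice c E z)%:E); last first.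
    by apply: eq_integral => -[].
  rewrite [RHS](@ge0_integral_plane_affine R (2 * rho * c)%R (s1 / c) (s2 / c)
    (EFin \o slice c E)); last 4 first.
  - by rewrite mulf_neq0 ?invr_eq0 ?(gt_eqF s10).
  - by rewrite mulf_neq0 ?invr_eq0 ?(gt_eqF s20).
  - by apply/measurable_EFinP; exact: measurable_slice.
  - by move=> z; rewrite lee_fin.
  rewrite -[RHS]ge0_integralZl_EFin//.
  - by apply: eq_integral => z _; rewrite /f normal_slice// EFinM.
  - by move=> z _; rewrite lee_fin.
  - apply/measurable_EFinP; apply: (measurableT_comp (measurable_slice c mE)
      (g := fun z : RR * RR => ((z.1 + z.2 - 2 * rho * c) / (s1 / c),
         (z.1 - z.2) / (s2 / c))%R)).
    by solve_measurable.
rewrite ge0_integral_square//.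
pose k u := ((Num.sqrt (2 * pi))^-1 * mixture 2^-1 u * \1_E u)%R.
have mk : measurable_fun setT (EFin \o k).
  apply/measurable_EFinP/measurable_funM => //.
  by apply: measurable_funM => //; exact: measurable_mixture.
have k0 u : 0 <= (k u)%:E.
  rewrite lee_fin; apply: mulr_ge0 => //; apply: mulr_ge0; last exact: mixture_ge0.
  by rewrite invr_ge0.
transitivity (\int[mu3]_u (k u)%:E); last first.
  rewrite [RHS]integral_mkcond; apply: eq_integral => z _.
  by rewrite patchE /k indicE; case: ifPn => zE; rewrite ?mulr1 ?mulr0.
rewrite (lebesgue3_tonelli mk k0) integral_mkcond; apply: eq_integral => w _.
rewrite patchE; case: ifPn => [|] w0.
  move: w0; rewrite inE /= in_itv/= andbT => w0.
  rewrite -ge0_integralZl_EFin ?powR_ge0//.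
  - apply: eq_integral => -[p q] _; rewrite /k /mixture/= gamma_kernelE//.
    by rewrite -EFinM; congr (_%:E); ring.
  - by move=> z _; exact: (h0 (z, w)).
  - rewrite (_ : (fun z => _) = (fun z => h (z, w))); last by apply/funext => -[].
    exact: (measurableT_comp mh (pair2_measurable w)).
rewrite integral0_eq// => z _; rewrite /k /mixture/= gamma_kernel0 ?mul0r ?mulr0 ?mul0r//.
by move: w0; rewrite notin_setE /= in_itv/= andbT => /negP; rewrite -leNgt.
Qed.

End single_observation.

(** * Bessel and Gamma integrals *)

Section special_functions.
Context (R : realType).
Notation RR := (measurableTypeR R).
Notation R3 := (RR * RR * RR)%type.
Notation mu := (@lebesgue_measure R).
Notation mu2 := (lebesgue2 R).
Notation mu3 := (lebesgue3 R).

(** An infinite x is covered, as fine sends infinities to 0. *)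
Lemma fine_mulr (c : R) (x : \bar R) : 0 < c -> fine (c%:E * x)%E = c * fine x.
Proof.
by move=> c0; case: x => //=; rewrite ?gt0_muley ?gt0_muleNy ?lte_fin//= mulr0.
Qed.

Local Open Scope ereal_scope.

(** Substituting w = r exp t symmetrizes the exponent to - 2 g r cosh t, and
    folding t with - t turns exp (nu t) into cosh (nu t).  Stated in extended
    reals, so that no convergence has to be known. *)
Lemma integral_besselK (nu r g : R) : (0 < r)%R -> (0 < g)%R ->
  \int[mu]_(w in `]0%R, +oo[)
    (w `^ (nu - 1) * expR (- (g * (r ^+ 2 * w `^ (- 1) + w))))%:E =
  (2 * r `^ nu)%:E * \int[mu]_(t in `[0%R, +oo[)
    (expR (- (2 * g * r * coshR t)) * coshR (nu * t))%:E.
Proof.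
move=> r0 g0.
pose F (w : RR) := (w `^ (nu - 1) * expR (- (g * (r ^+ 2 * w `^ (- 1) + w))))%:E.
have mF : measurable_fun setT F by rewrite /F; solve_measurable.
have F0 w : 0 <= F w by rewrite lee_fin mulr_ge0 ?powR_ge0 ?expR_ge0.
pose h (t : RR) := (r `^ nu * (expR (nu * t) *
  expR (- (g * r * (expR t + expR (- t))))))%:E.
have mh : measurable_fun setT h by rewrite /h; solve_measurable.
have h0 t : 0 <= h t by rewrite lee_fin !mulr_ge0 ?powR_ge0 ?expR_ge0.
rewrite (ge0_integral_expR mF F0).
have mF' : measurable_fun setT (fun t : RR => (expR t)%:E * F (expR t)).
  apply: emeasurable_funM; first by solve_measurable.
  by apply: (measurableT_comp mF (g := expR)); exact: measurable_expR.
rewrite (@ge0_integral_affine R 1 (ln r)) ?oner_eq0//; last first.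
  by move=> t; rewrite mule_ge0 ?lee_fin ?expR_ge0.
rewrite normr1 mul1e.
transitivity (\int[mu]_t h t).
  apply: eq_integral => t _; rewrite mul1r expRD lnK ?posrE// /F /h -EFinM.
  congr (_%:E).
  have tr0 : (0 < expR t * r)%R by rewrite mulr_gt0 ?expR_gt0.
  rewrite powR_inv1 ?ltW// [LHS]mulrA mulr_powRB1//.
  rewrite powRM ?expR_ge0 ?ltW// -expRM [(t * nu)%R]mulrC -[LHS]mulrA [LHS]mulrCA.
  congr (_ * (_ * expR _))%R; rewrite expRN.
  by field; rewrite (gt_eqF r0) (gt_eqF (expR_gt0 t)).
have mK : measurable_fun setT
    (fun t : RR => (expR (- (2 * g * r * coshR t)) * coshR (nu * t))%:E).
  by rewrite /coshR; solve_measurable.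
rewrite ge0_integral_reflect// -[in RHS]integral_itv_obnd_cbnd; last first.
  exact: measurable_funTS.
rewrite -ge0_integralZl_EFin//; last 3 first.
- by move=> t _; rewrite lee_fin /coshR !mulr_ge0 ?invr_ge0 ?addr_ge0 ?expR_ge0.
- exact: measurable_funTS.
- by rewrite mulr_ge0 ?powR_ge0.
apply: eq_integral => t _; rewrite /h /coshR -EFinD -EFinM opprK mulrN.
congr (_%:E); rewrite [(expR (- t) + _)%R]addrC.
rewrite (_ : 2 * g * r * ((expR t + expR (- t)) / 2) =
  g * r * (expR t + expR (- t)))%R; last by field.
by field.
Qed.

Lemma integral_gamma_kernel (a : R) :
  \int[mu]_w (gamma_kernel a w)%:E = (2 `^ a)%:E *
  \int[mu]_(t in `]0%R, +oo[) (t `^ (a - 1) * expR (- t))%:E.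
Proof.
have mg : measurable_fun setT (fun w : RR => (gamma_kernel a w)%:E).
  by apply/measurable_EFinP; exact: measurable_gamma_kernel.
rewrite (@ge0_integral_affine R 2 0)//; last first.
  by move=> w; rewrite lee_fin gamma_kernel_ge0.
rewrite [in RHS]integral_mkcond.
have -> : (2 `^ a = 2 * 2 `^ (a - 1))%R.
  by rewrite mulr_powRB1.
rewrite EFinM -muleA ger0_norm//; congr (_ * _).
rewrite -ge0_integralZl_EFin; last 4 first.
- exact: measurableT.
- by move=> t _; rewrite patchE; case: ifPn => // _; rewrite lee_fin mulr_ge0 ?powR_ge0 ?expR_ge0.
- apply/measurable_restrict.
  + exact: measurable_itv.
  + exact: measurableT.
  + by rewrite setTI; apply: measurable_funTS; solve_measurable.
- exact: powR_ge0.
apply: eq_integral => t _; rewrite addr0 patchE; case: ifPn => t0.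
  move: t0; rewrite inE/= in_itv/= andbT => t0.
  rewrite gamma_kernelE ?mulr_gt0// powRM ?ltW// -EFinM mulrA.
  by congr (_ * expR _)%:E; field.
rewrite mule0 gamma_kernel0//.
move: t0; rewrite notin_setE /= in_itv/= andbT => /negP; rewrite -leNgt => t0.
by rewrite pmulr_rle0.
Qed.

Lemma integral_mixture (a : R) :
  \int[mu3]_z (mixture a z)%:E = \int[mu]_w (gamma_kernel a w)%:E.
Proof.
rewrite lebesgue3_tonelli; last 2 first.
- by apply/measurable_EFinP; exact: measurable_mixture.
- by move=> z; rewrite lee_fin mixture_ge0.
apply: eq_integral => w _.
have [w0|w0] := leP w 0%R.
  by rewrite gamma_kernel0// integral0_eq// => z _; rewrite /mixture/= gamma_kernel0// mul0r.
have g1 : \int[mu]_p (gauss_kernel w p)%:E = 1.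
  rewrite -[RHS](@integral_normal_pdf R 0 (Num.sqrt w)); apply: eq_integral => p _.
  rewrite gauss_kernelE// normal_pdfE ?gt_eqF ?sqrtr_gt0//.
  rewrite /normal_peak /normal_fun sqr_sqrtr ?ltW// subr0.
  by congr ((Num.sqrt _)^-1 * expR (_ / _))%:E; ring.
rewrite lebesgue2_tonelli; last 2 first.
- apply/measurable_EFinP.
  exact: (measurableT_comp (measurable_mixture a) (pair2_measurable w)).
- by move=> z; rewrite lee_fin mixture_ge0.
transitivity (\int[mu]_p ((gamma_kernel a w)%:E * (gauss_kernel w p)%:E)).
  apply: eq_integral => p _; rewrite /mixture/=.
  under eq_integral do rewrite mulrA EFinM.
  rewrite ge0_integralZl_EFin; last 4 first.
  + exact: measurableT.
  + by move=> q _; rewrite lee_fin gauss_kernel_ge0.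
  + by apply/measurable_EFinP; apply: measurable_gauss_kernelT; solve_measurable.
  + by kernel_ge0.
  by rewrite g1 mule1 EFinM.
rewrite ge0_integralZl_EFin; last 4 first.
+ exact: measurableT.
+ by move=> q _; rewrite lee_fin gauss_kernel_ge0.
+ by apply/measurable_EFinP; apply: measurable_gauss_kernelT; solve_measurable.
+ by kernel_ge0.
by rewrite g1 mule1.
Qed.

(** Total mass 1; in particular Euler's integral at a converges. *)
Lemma mixture_law_constant (nu : probability R3 R) (a c : R) : (0 <= c)%R ->
    (forall A, measurable A -> nu A = \int[mu3]_(z in A) (c * mixture a z)%:E) ->
  (c * 2 `^ a * Gamma a = 1)%R.
Proof.
move=> c0 nuE; have := nuE setT measurableT; rewrite probability_setT.
under eq_integral do rewrite EFinM.
rewrite ge0_integralZl_EFin//; last 2 first.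
- by move=> z _; rewrite lee_fin mixture_ge0.
- by apply/measurable_EFinP; exact: measurable_mixture.
rewrite integral_mixture integral_gamma_kernel muleA -EFinM /Gamma /Rintegral.
set G := integral _ _ _; have G0 : 0 <= G.
  by apply: integral_ge0 => t _; rewrite lee_fin mulr_ge0 ?powR_ge0 ?expR_ge0.
have k0 : (0 <= c * 2 `^ a)%R by rewrite mulr_ge0 ?powR_ge0.
move: (c * 2 `^ a)%R k0 => k k0; case: G G0 => [g _|_|//].
  by rewrite -EFinM => -[].
move: k0; rewrite le_eqVlt => /predU1P[<-|k0].
  by rewrite mul0e => /eqP; rewrite onee_eq0.
by rewrite gt0_muley.
Qed.

End special_functions.

(** * Density of the pair of sample covariances *)

Section covariance_density.
Context (R : realType) (rho sigma a c : R).
Hypotheses (hsigma : 0 < 1 - sigma) (hsigma' : 0 < 1 + sigma)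
  (hrho : 0 < 1 - 2 * rho ^+ 2 + sigma) (c_gt0 : 0 < c).
Notation RR := (measurableTypeR R).
Notation R3 := (RR * RR * RR)%type.
Notation mu := (@lebesgue_measure R).
Notation mu2 := (lebesgue2 R).
Notation mu3 := (lebesgue3 R).
Let xi := 1 - 2 * rho ^+ 2 + sigma.
Let s1 := Num.sqrt (2 * xi).
Let s2 := Num.sqrt (2 * (1 - sigma)).

(** Recovers (sum A C, sum B C) from the sums of (U C, V C, C^2), by
    A C + B C = 2 rho C^2 + sqrt (2 xi) U C and
    A C - B C = sqrt (2 (1 - sigma)) V C. *)
Definition covariance_pair (z : R3) : RR * RR :=
  ((2 * rho * z.2 + Num.sqrt (2 * (1 - 2 * rho ^+ 2 + sigma)) * z.1.1
    + Num.sqrt (2 * (1 - sigma)) * z.1.2) / 2,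
   (2 * rho * z.2 + Num.sqrt (2 * (1 - 2 * rho ^+ 2 + sigma)) * z.1.1
    - Num.sqrt (2 * (1 - sigma)) * z.1.2) / 2).

(** Joint density of the pair of covariances and of the mixing variable. *)
Let joint (u : R3) : R := 2 / (s1 * s2) *
  (c * mixture a ((u.1.1 + u.1.2 - 2 * rho * u.2) / s1, (u.1.1 - u.1.2) / s2, u.2)).

Definition covariance_density (z : RR * RR) : \bar R :=
  (\int[mu]_w (joint (z, w))%:E)%E.

Let s10 : 0 < s1. Proof. by rewrite sqrtr_gt0 mulr_gt0. Qed.
Let s20 : 0 < s2. Proof. by rewrite sqrtr_gt0 mulr_gt0. Qed.

Lemma measurable_covariance_pair : measurable_fun setT covariance_pair.
Proof. by rewrite /covariance_pair; solve_measurable. Qed.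

Let joint_ge0 u : 0 <= joint u.
Proof.
apply: mulr_ge0; first by rewrite divr_ge0// ltW// mulr_gt0.
by apply: mulr_ge0; [exact: ltW|exact: mixture_ge0].
Qed.

Let measurable_joint : measurable_fun setT joint.
Proof.
apply: measurable_funM => //; apply: measurable_funM => //.
apply: (measurableT_comp (measurable_mixture a) (g := fun u : R3 =>
  ((u.1.1 + u.1.2 - 2 * rho * u.2) / s1, (u.1.1 - u.1.2) / s2, u.2))).
by solve_measurable.
Qed.

Local Open Scope ereal_scope.

Lemma covariance_density_ge0 z : 0 <= covariance_density z.
Proof. by apply: integral_ge0 => w _; rewrite lee_fin. Qed.

Lemma measurable_covariance_density : measurable_fun setT covariance_density.
Proof.
apply: (@measurable_fun_fubini_tonelli_F _ _ _ _ _ _ (fun u : R3 => (joint u)%:E)).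
  exact/measurable_EFinP.
by move=> u; rewrite lee_fin.
Qed.

(** The affine substitution in the plane at fixed mixing variable, and an
    exchange of integrals. *)
Lemma covariance_density_law (E : set (RR * RR)) : measurable E ->
  \int[mu3]_(z in covariance_pair @^-1` E) (c * mixture a z)%:E =
  \int[mu2]_(z in E) covariance_density z.
Proof.
move=> mE.
have mcp := measurable_covariance_pair.
have m1E : measurable_fun setT (\1_E : RR * RR -> R) by exact: measurable_indic.
pose f (z : R3) := (c * mixture a z * \1_E (covariance_pair z))%R.
have mf : measurable_fun setT (EFin \o f).
  apply/measurable_EFinP/measurable_funM; last exact: (measurableT_comp m1E mcp).
  by apply: measurable_funM => //; exact: measurable_mixture.
have f0 z : 0 <= (f z)%:E.
  rewrite lee_fin; apply: mulr_ge0 => //.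
  by apply: mulr_ge0; [exact: ltW|exact: mixture_ge0].
pose g (u : R3) := (joint u * \1_E u.1)%R.
have mg : measurable_fun setT (EFin \o g).
  apply/measurable_EFinP/measurable_funM => //.
  exact: (measurableT_comp m1E measurable_fst).
have g0 z : 0 <= (g z)%:E by rewrite lee_fin; apply: mulr_ge0.
transitivity (\int[mu3]_z (f z)%:E).
  rewrite integral_mkcond; apply: eq_integral => z _.
  by rewrite patchE /f indicE; case: ifPn => zE;
    [rewrite mem_set ?mulr1//; rewrite inE in zE
    |rewrite memNset ?mulr0//; rewrite notin_setE in zE].
rewrite (lebesgue3_tonelli mf f0).
transitivity (\int[mu]_w \int[mu2]_z (g (z, w))%:E).
  apply: eq_integral => w _.
  rewrite (@ge0_integral_plane_affine R (2 * rho * w)%R s1 s2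
    (fun z => (f (z, w))%:E)) ?gt_eqF//; last first.
    exact: (measurableT_comp mf (pair2_measurable w)).
  rewrite -ge0_integralZl_EFin; last 4 first.
  - exact: measurableT.
  - by move=> z _; exact: f0.
  - apply: (measurableT_comp mf (g := fun z : RR * RR =>
      ((z.1 + z.2 - 2 * rho * w) / s1, (z.1 - z.2) / s2, w)%R)).
    by solve_measurable.
  - by rewrite divr_ge0.
  apply: eq_integral => -[x y] _; rewrite -EFinM; congr (_%:E).
  rewrite /f /g /joint /= [LHS]mulrA gtr0_norm ?mulr_gt0//; congr (_ * \1_E _)%R.
  rewrite /covariance_pair /= -/xi -/s1 -/s2.
  by congr (_, _); field; rewrite (gt_eqF s10) (gt_eqF s20).
rewrite (lebesgue3_tonelli_swap mg g0) [RHS]integral_mkcond.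
apply: eq_integral => z _; rewrite patchE /g /= indicE; case: ifPn => zE.
  by apply: eq_integral => w _; rewrite mulr1.
by rewrite integral0_eq// => w _; rewrite mulr0.
Qed.

(** With g = (1 + sigma) / (2 xi) and g r^2 = q / 4, the exponent of the joint
    density splits as (x + y) rho / xi - g (r^2 / w + w), which is the form of
    [integral_besselK].  At the origin q = 0, whence the hypothesis. *)
Lemma covariance_densityE (x y : R) : (x, y) <> (0, 0)%R ->
  let lambda := (1 / Num.sqrt (1 - sigma))%R in
  let kappa := (1 / Num.sqrt xi)%R in
  let alpha := (Num.sqrt (2 * ((1 + sigma) / (1 - sigma))) / xi)%R in
  let q := (kappa ^+ 2 * (x + y) ^+ 2 + lambda ^+ 2 * (x - y) ^+ 2)%R in
  (fine (covariance_density (x, y)) =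
  c * (lambda `^ a * kappa `^ a / (pi * alpha `^ (a - 1))) *
  expR ((x + y) / 2 * (2 * rho / xi)) * q `^ ((a - 1) / 2) *
  besselK (a - 1) (alpha / (2 * lambda * kappa) * Num.sqrt q))%R.
Proof.
move=> xy0 lambda kappa alpha q.
have l0 : (0 < lambda)%R by rewrite divr_gt0// sqrtr_gt0.
have k0 : (0 < kappa)%R by rewrite divr_gt0// sqrtr_gt0.
have al0 : (0 < alpha)%R by rewrite divr_gt0// sqrtr_gt0 mulr_gt0// divr_gt0.
have l2 : (lambda ^+ 2 = (1 - sigma)^-1)%R.
  by rewrite /lambda expr_div_n expr1n sqr_sqrtr ?ltW// mul1r.
have k2 : (kappa ^+ 2 = xi^-1)%R.
  by rewrite /kappa expr_div_n expr1n sqr_sqrtr ?ltW// mul1r.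
have al2 : (alpha ^+ 2 = 2 * ((1 + sigma) / (1 - sigma)) / xi ^+ 2)%R.
  by rewrite /alpha expr_div_n sqr_sqrtr// mulr_ge0// divr_ge0 ?ltW.
have s12 : (2 / (s1 * s2) = lambda * kappa)%R.
  rewrite /s1 /s2 !sqrtrM// mulrACA -expr2 sqr_sqrtr// /lambda /kappa.
  by field; rewrite !gt_eqF ?sqrtr_gt0.
clearbody lambda kappa alpha.
have q0 : (0 < q)%R.
  have t0 (u v : R) : (0 <= u ^+ 2 * v ^+ 2)%R by rewrite -exprMn sqr_ge0.
  rewrite lt_neqAle eq_sym addr_ge0 ?t0// andbT.
  rewrite paddr_eq0 ?t0// -!exprMn !sqrf_eq0 !mulf_eq0.
  rewrite (gt_eqF l0) (gt_eqF k0)/= subr_eq0.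
  apply/negP => /andP[xy /eqP xEy]; apply: xy0.
  by move: xy; rewrite xEy -mulr2n mulrn_eq0/= => /eqP ->.
(* Written so that 2 g r = alpha / (2 lambda kappa) sqrt q. *)
pose r := (Num.sqrt q * (lambda * kappa) / alpha)%R.
have r0 : (0 < r)%R by rewrite divr_gt0// !mulr_gt0// sqrtr_gt0.
have r2 : (r ^+ 2 = q * xi / (2 * (1 + sigma)))%R.
  rewrite /r expr_div_n !exprMn sqr_sqrtr ?ltW// l2 k2 al2.
  by field; rewrite !gt_eqF.
have rdef : r = (Num.sqrt q * (lambda * kappa) / alpha)%R by [].
clearbody r.
pose g := ((1 + sigma) / (2 * xi))%R.
have g0 : (0 < g)%R by rewrite divr_gt0// mulr_gt0.
pose C1 := (c * (lambda * kappa / (2 * pi)) *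
  expR ((x + y) / 2 * (2 * rho / xi)))%R.
have C10 : (0 < C1)%R.
  apply: mulr_gt0; last exact: expR_gt0.
  by apply: mulr_gt0 => //; apply: divr_gt0; rewrite mulr_gt0// pi_gt0.
have densE : covariance_density (x, y) = C1%:E * \int[mu]_(w in `]0%R, +oo[)
    (w `^ (a - 1 - 1) * expR (- (g * (r ^+ 2 * w `^ (- 1) + w))))%:E.
  rewrite [in RHS]integral_mkcond -ge0_integralZl_EFin; last 4 first.
  - exact: measurableT.
  - by move=> w _; rewrite patchE; case: ifPn => // _; rewrite lee_fin mulr_ge0 ?powR_ge0 ?expR_ge0.
  - apply/measurable_restrict.
    + exact: measurable_itv.
    + exact: measurableT.
    + by rewrite setTI; apply: measurable_funTS; solve_measurable.
  - exact: ltW.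
  apply: eq_integral => w _; rewrite patchE; case: ifPn => w0; last first.
    rewrite mule0 /joint /mixture/= gamma_kernel0 ?mul0r ?mulr0//.
    by move: w0; rewrite notin_setE /= in_itv/= andbT => /negP; rewrite -leNgt.
  move: w0; rewrite inE/= in_itv/= andbT => w0; rewrite -EFinM; congr (_%:E).
  rewrite /joint /mixture /= s12 gamma_kernelE// !gauss_kernelE//.
  rewrite powR_inv1 ?ltW// -(mulr_powRB1 (a - 1) w0).
  rewrite !expr_div_n !sqr_sqrtr ?mulr_ge0 ?ltW//.
  set S := Num.sqrt (2 * pi * w); set W := (w `^ (a - 1 - 1))%R.
  have SE : (S^-1 * S^-1 = (2 * pi * w)^-1)%R.
    by rewrite -invfM -expr2 sqr_sqrtr// mulr_ge0 ?mulr_ge0 ?pi_ge0// ltW.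
  set u := ((x + y - 2 * rho * w) ^+ 2 / (2 * xi))%R.
  set v := ((x - y) ^+ 2 / (2 * (1 - sigma)))%R.
  have expE : (expR (- w / 2) * (expR (- u / (2 * w)) * expR (- v / (2 * w))) =
      expR ((x + y) / 2 * (2 * rho / xi)) * expR (- (g * (r ^+ 2 / w + w))))%R.
    rewrite -!expRD; congr expR; rewrite r2 /q l2 k2 /g /u /v /xi.
    by field; rewrite !gt_eqF.
  transitivity (lambda * kappa * c * (w * W) * (S^-1 * S^-1) *
    (expR (- w / 2) * (expR (- u / (2 * w)) * expR (- v / (2 * w)))))%R; first by ring.
  rewrite expE SE /C1; move: (pi_gt0 R); move: (pi : R) => p p0.
  by field; rewrite (gt_eqF w0) (gt_eqF p0).
rewrite densE (integral_besselK _ r0 g0).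
rewrite fine_mulr// fine_mulr; last by rewrite mulr_gt0// powR_gt0.
have -> : (2 * g * r = alpha / (2 * lambda * kappa) * Num.sqrt q)%R.
  have -> : (g = alpha ^+ 2 / (4 * (lambda ^+ 2 * kappa ^+ 2)))%R.
    by rewrite al2 l2 k2 /g; field; rewrite !gt_eqF.
  by rewrite rdef; field; rewrite (gt_eqF l0) (gt_eqF k0) (gt_eqF al0).
rewrite -[fine (integral _ _ _)]/(besselK (a - 1) _).
rewrite mulrA; congr (_ * _)%R.
have rE : (r `^ (a - 1) * alpha `^ (a - 1) =
    q `^ ((a - 1) / 2) * (lambda `^ (a - 1) * kappa `^ (a - 1)))%R.
  rewrite -powRM ?ltW// rdef divfK ?gt_eqF// !powRM ?sqrtr_ge0 ?mulr_ge0 ?ltW//.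
  by rewrite -powR12_sqrt ?ltW// -powRrM mulrC [(2^-1 * _)%R]mulrC mulrC.
rewrite -(mulr_powRB1 a l0) -(mulr_powRB1 a k0).
have := powR_gt0 (a - 1) al0; move: (alpha `^ (a - 1))%R rE => A rE A0.
have -> : (r `^ (a - 1) = q `^ ((a - 1) / 2) * (lambda `^ (a - 1) * kappa `^ (a - 1)) / A)%R.
  by rewrite -rE mulfK// gt_eqF.
rewrite /C1; move: (pi_gt0 R); move: (pi : R) => p p0.
by field; rewrite !gt_eqF.
Qed.

End covariance_density.

(** * Sums over the sample *)

Section sample.
Context (R : realType) d (T : measurableType d) (P : probability T R).
Context (rho sigma : R) (n : nat) (A B C : 'I_n -> {RV P >-> R}).
Hypotheses (hsigma : 0 < 1 - sigma) (hrho : 0 < 1 - 2 * rho ^+ 2 + sigma).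
Hypothesis hindep : mutually_independent P (fun j t => (A j t, B j t, C j t)).
Hypothesis hnormal : forall j : 'I_n,
  trivariate_normal P (fun t => (A j t, B j t, C j t)) 0 (Sigma rho sigma).
Notation RR := (measurableTypeR R).
Notation R3 := (RR * RR * RR)%type.
Notation mu3 := (lebesgue3 R).

Let obs (j : 'I_n) (t : T) : R3 := (A j t, B j t, C j t).

Let measurable_obs j : measurable_fun setT (obs j).
Proof.
have mRV (X : {RV P >-> R}) : measurable_fun setT (X : T -> RR).
  by have mX : measurable_fun setT (X : T -> R) by exact: measurable_funP; exact: mX.
by do 2 (apply: measurable_fun_pair => //).
Qed.

Let measurable_triple j : measurable_fun setT (product_triple rho sigma \o obs j).
Proof. exact: (measurableT_comp (measurable_product_triple rho sigma)). Qed.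

Let triple j : {mfun T >-> R3} := HB.pack (product_triple rho sigma \o obs j)
  (isMeasurableFun.Build _ _ _ _ _ (measurable_triple j)).

Let sums (k : nat) (t : T) : R3 :=
  (\sum_(i < n | (i < k)%N) (triple i t).1.1,
   \sum_(i < n | (i < k)%N) (triple i t).1.2,
   \sum_(i < n | (i < k)%N) (triple i t).2).

Let measurable_sums k : measurable_fun setT (sums k).
Proof.
have msum (F : 'I_n -> T -> RR) : (forall i, measurable_fun setT (F i)) ->
    measurable_fun setT ((fun t => \sum_(i < n | (i < k)%N) F i t) : T -> RR).
  move=> mF.
  rewrite (_ : (fun t => _) =
      fun t => \sum_(i < n) (if (i < k)%N then F i t else 0)); last first.
    by apply/funext => t; rewrite big_mkcond.
  by apply: measurable_sum => i; case: (i < k)%N; [exact: mF|exact: measurable_cst].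
have mt i : measurable_fun setT (triple i) by exact: measurable_triple.
apply: measurable_fun_pair; first apply: measurable_fun_pair.
- apply: msum => i.
  exact: (measurableT_comp measurable_fst (measurableT_comp measurable_fst (mt i))).
- apply: msum => i.
  exact: (measurableT_comp measurable_snd (measurableT_comp measurable_fst (mt i))).
- by apply: msum => i; exact: (measurableT_comp measurable_snd (mt i)).
Qed.

Let partial_sums k : {mfun T >-> R3} := HB.pack (sums k)
  (isMeasurableFun.Build _ _ _ _ _ (measurable_sums k)).

Let partial_sums0 t : partial_sums 0 t = (0, 0, 0).
Proof. by rewrite /= /sums !big_pred0. Qed.

Let partial_sumsS (i : 'I_n) t :
  partial_sums i.+1 t = add3 (partial_sums i t, triple i t).
Proof.
have S (F : 'I_n -> R) :
    \sum_(j < n | (j < i.+1)%N) F j = \sum_(j < n | (j < i)%N) F j + F i.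
  rewrite (bigD1 i)//= addrC; congr (_ + _); apply: eq_bigl => j.
  by rewrite ltnS [RHS]ltn_neqAle andbC.
by rewrite /= /sums /add3 /= !S.
Qed.

Let independent_triple : mutually_independent P (fun j => triple j : T -> R3).
Proof.
move=> J E mE; apply: (hindep J (E := fun j => product_triple rho sigma @^-1` E j)).
move=> j; rewrite -[X in measurable X]setTI.
exact: measurable_product_triple.
Qed.

Let triple_law j : has_mixture_law (distribution P (triple j)) 2^-1.
Proof.
exists (Num.sqrt (2 * pi))^-1; first by rewrite invr_ge0.
move=> E mE; rewrite -(product_triple_law hsigma hrho mE).
have [_ _ lawE] := hnormal j; apply: lawE.
rewrite -[X in measurable X]setTI.
exact: measurable_product_triple.
Qed.

Let has_mixture_law_ext (nu nu' : set R3 -> \bar R) a :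
  (forall E, measurable E -> nu' E = nu E) ->
  has_mixture_law nu a -> has_mixture_law nu' a.
Proof. by move=> e [c c0 H]; exists c => // E mE; rewrite e// H. Qed.

Let partial_sums_law (k : nat) : (k < n)%N ->
  has_mixture_law (distribution P (partial_sums k.+1)) (k.+1%:R / 2).
Proof.
elim: k => [|k IHk] kn.
  rewrite div1r; apply: has_mixture_law_ext (triple_law (Ordinal kn)) => E _.
  have S1 : (partial_sums 1 : T -> R3) = triple (Ordinal kn).
    apply/funext => t; rewrite (partial_sumsS (Ordinal kn)) partial_sums0.
    by rewrite /add3 !add0r; case: (triple _ t) => [[]].
  by rewrite /distribution S1.
rewrite (_ : k.+2%:R / 2 = k.+1%:R / 2 + 2^-1); last first.
  by rewrite [k.+2%:R]mulrSr mulrDl div1r.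
apply: has_mixture_law_ext
  (mixture_law_conv (IHk (ltnW kn)) (triple_law (Ordinal kn))) => E mE.
exact: (partial_sum_law (@measurable_add3 R) partial_sums0 partial_sumsS
  independent_triple (Ordinal kn) mE).
Qed.

Lemma triple_sum_law : (0 < n)%N ->
  exists2 S : {mfun T >-> R3}, has_mixture_law (distribution P S) (n%:R / 2) &
    forall t, covariance_pair rho sigma (S t) =
      (\sum_(j < n) A j t * C j t, \sum_(j < n) B j t * C j t).
Proof.
move=> n0; exists (partial_sums n).
  by have := @partial_sums_law n.-1; rewrite prednK//; exact.
move=> t; have s10 : Num.sqrt (2 * (1 - 2 * rho ^+ 2 + sigma)) != 0.
  by rewrite gt_eqF// sqrtr_gt0 mulr_gt0.
have s20 : Num.sqrt (2 * (1 - sigma)) != 0 by rewrite gt_eqF// sqrtr_gt0 mulr_gt0.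
have sumT (F : 'I_n -> R) : \sum_(i < n | (i < n)%N) F i = \sum_(i < n) F i.
  by apply: eq_bigl => i; rewrite ltn_ord.
rewrite /covariance_pair /= /sums /= !sumT !mulr_sumr -!big_split -!sumrB /=.
rewrite !mulr_suml; congr (_, _); apply: eq_bigr => i _; rewrite /obs /=.
  by field; rewrite s10 s20.
by field; rewrite s10 s20.
Qed.

End sample.

Theorem mainTheorem1 (R : realType) (d : measure_display)
    (T : measurableType d) (P : probability T R)
    (rho sigma : R) (n : nat) (A B C : 'I_n -> {RV P >-> R})
    (hsigma : 0 < 1 - sigma ^+ 2)
    (hrho : 0 < 1 - 2 * rho ^+ 2 + sigma)
    (hn : (1 <= n)%N)
    (hindep : mutually_independent P (fun j t => (A j t, B j t, C j t)))
    (hnormal : forall j : 'I_n,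
       trivariate_normal P (fun t => (A j t, B j t, C j t)) 0
         (Sigma rho sigma)) :
  let gammaAC := fun t => \sum_(j < n) A j t * C j t in
  let gammaBC := fun t => \sum_(j < n) B j t * C j t in
  let xi := 1 - 2 * rho ^+ 2 + sigma in
  let eta := (1 + sigma) / (1 - sigma) in
  let lambda := 1 / Num.sqrt (1 - sigma) in
  let kappa := 1 / Num.sqrt (1 - 2 * rho ^+ 2 + sigma) in
  let delta := 2 * rho / xi in
  let alpha := Num.sqrt (2 * eta) / xi in
  exists f : R * R -> R,
    has_density P (@lebesgue2 R) (fun t => (gammaAC t, gammaBC t)) f /\
    forall x y : R, (x, y) <> (0, 0) ->
      let q := kappa ^+ 2 * (x + y) ^+ 2 + lambda ^+ 2 * (x - y) ^+ 2 in
      f (x, y) =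
        1 / Gamma (n%:R / 2) *
        ((lambda `^ (n%:R / 2) * kappa `^ (n%:R / 2)) /
         (2 `^ (n%:R / 2) * pi * alpha `^ ((n%:R - 2) / 2))) *
        expR ((x + y) / 2 * delta) *
        q `^ ((n%:R - 2) / 4) *
        besselK ((n%:R - 2) / 2) (alpha / (2 * lambda * kappa) * Num.sqrt q).
Proof.
move=> gammaAC gammaBC xi eta lambda kappa delta alpha.
have hs1 : 0 < 1 - sigma by nra.
have hs2 : 0 < 1 + sigma by nra.
have [S [c c0 SE] pairE] := triple_sum_law hs1 hrho hindep hnormal hn.
set a := n%:R / 2 in SE.
have cE := mixture_law_constant c0 SE.
have c_gt0 : 0 < c.
  rewrite lt_neqAle c0 andbT; apply/eqP => c00.
  by move: cE; rewrite -c00 !mul0r => /esym/eqP; rewrite oner_eq0.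
have mD := measurable_covariance_density a hs1 hrho c_gt0.
have D0 := covariance_density_ge0 a hs1 hrho c_gt0.
pose D := covariance_density rho sigma a c.
have lawE (E : set (measurableTypeR R * measurableTypeR R)) : measurable E ->
    P ((fun t => (gammaAC t, gammaBC t)) @^-1` E) =
    (\int[lebesgue2 R]_(z in E) D z)%E.
  move=> mE; rewrite -(covariance_density_law a hs1 hrho c_gt0 mE) -SE; last first.
    rewrite -[X in measurable X]setTI.
    exact: measurable_covariance_pair.
  rewrite /distribution /pushforward; congr (P _).
  by apply/seteqP; split=> t /=; rewrite pairE.
(* D may be infinite on a null set only, so that fine \o D is a version of it. *)
have D_int : (lebesgue2 R).-integrable setT D.
  apply/integrableP; split=> //.
  under eq_integral do rewrite gee0_abs//.
  by rewrite -lawE// preimage_setT probability_setT ltry.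
exists (fine \o D); split; last first.
  move=> x y xy q.
  rewrite /= covariance_densityE//.
  have Gamma0 : Gamma a != 0.
    by apply/eqP => G0; move: cE; rewrite G0 mulr0 => /esym/eqP; rewrite oner_eq0.
  have p20 : 2 `^ a != 0 :> R by rewrite gt_eqF// powR_gt0.
  have -> : c = 1 / Gamma a / 2 `^ a.
    by rewrite -[LHS](mulfK p20) -[X in X / _ = _](mulfK Gamma0) cE.
  rewrite (_ : (n%:R - 2) / 2 = a - 1); last by rewrite /a; field.
  rewrite (_ : (n%:R - 2) / 4 = (a - 1) / 2); last by rewrite /a; field.
  congr (_ * _ * _ * _); rewrite -/a -/xi -/eta -/lambda -/kappa -/alpha.
  by rewrite -!mulrA; congr (_ * _); rewrite !invfM; ring.
split.
- by apply: measurableT_comp => //; exact: fine_measurable.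
- by move=> z; exact: fine_ge0.
- move=> E mE; rewrite lawE//; apply: ae_eq_integral => //.
  + exact: measurable_funTS.
  + apply/measurable_EFinP; apply: measurable_funTS.
    by apply: measurableT_comp => //; exact: fine_measurable.
  + have := integrable_ae measurableT D_int.
    by apply: filterS => z Dz _; rewrite /= fineK// Dz.
Qed.
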